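(* Consider, for $r>0$, the system $$\begin{cases}\partial_t h+\partial_r(hU)+\dfrac{hU}{r}=0,\\[4pt] \partial_t U+U\,\partial_r U+\partial_r h-V-\dfrac{V^2}{r}=0,\\[4pt] \partial_t V+U\,\partial_r V+U+\dfrac{VU}{r}=0.\end{cases}$$ If a solution $(h,U,V)$ of this system has the separated-variable form $$h(r,t)=\mathfrak{h}(t)\,\mathfrak{a}_1(r),\qquad U(r,t)=\mathfrak{u}(t)\,\mathfrak{a}_2(r),\qquad V(r,t)=\mathfrak{v}(t)\,\mathfrak{a}_3(r),$$ then the solution is either time periodic or blows up in finite time.
   Context: The system is the radially symmetric form of the two-dimensional rotating shallow water system, where $h$ is the fluid height, $U$ the radial velocity and $V$ the angular velocity component, with $r=\sqrt{x^2+y^2}$. Solutions are classical solutions (differentiable functions satisfying the equations pointwise). Steady (time-independent) solutions count as time periodic. *)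

(* Defs.v *)
From Stdlib Require Import Reals.
From Coquelicot Require Import Coquelicot.
Open Scope R_scope.

(* Fields are curried functions [f r t], radius first.  A lifespan [T : Rbar]
   stands for the open set of all [r > 0], [0 < t < T]; values of a field
   outside this set are irrelevant. *)

Definition in_dom (T : Rbar) (r t : R) : Prop :=
  0 < r /\ 0 < t /\ Rbar_lt t T.

Definition dr (f : R -> R -> R) (r t : R) : R := Derive (fun s => f s t) r.
Definition dt (f : R -> R -> R) (r t : R) : R := Derive (fun s => f r s) t.

(* Differentiability is joint in (r, t); it makes every [Derive] below a
   genuine derivative.  No sign is imposed on [h]. *)
Definition classical_solution (T : Rbar) (h U V : R -> R -> R) : Prop :=
  forall r t : R, in_dom T r t ->
    (differentiable_pt h r t /\
     differentiable_pt U r t /\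
     differentiable_pt V r t) /\
    dt h r t + dr (fun s w => h s w * U s w) r t + h r t * U r t / r = 0 /\
    dt U r t + U r t * dr U r t + dr h r t - V r t - (V r t)^2 / r = 0 /\
    dt V r t + U r t * dr V r t + U r t + V r t * U r t / r = 0.

Definition separated (T : Rbar) (h U V : R -> R -> R) : Prop :=
  exists hh uu vv a1 a2 a3 : R -> R,
    forall r t : R, in_dom T r t ->
      h r t = hh t * a1 r /\ U r t = uu t * a2 r /\ V r t = vv t * a3 r.

(* Used for solutions of infinite lifespan.  The period is any positive number,
   not necessarily minimal, so steady solutions qualify. *)
Definition time_periodic (h U V : R -> R -> R) : Prop :=
  exists P : R, 0 < P /\
    forall r t : R, 0 < r -> 0 < t ->
      h r (t + P) = h r t /\ U r (t + P) = U r t /\ V r (t + P) = V r t.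

(* Pointwise in [r], because a separated solution (e.g. one with [U]
   proportional to [r]) need not be bounded in space at any time. *)
Definition blows_up_at (Tb : R) (h U V : R -> R -> R) : Prop :=
  exists r : R, 0 < r /\
    filterlim (fun t => Rabs (h r t) + Rabs (U r t) + Rabs (V r t))
      (at_left Tb) (Rbar_locally p_infty).

(* [(h', U', V')], of lifespan [T'], is a continuation of [(h, U, V)], of
   lifespan [T], within the class of separated classical solutions. *)
Definition continuation (T : Rbar) (h U V : R -> R -> R)
    (T' : Rbar) (h' U' V' : R -> R -> R) : Prop :=
  Rbar_le T T' /\
  classical_solution T' h' U' V' /\
  separated T' h' U' V' /\
  forall r t : R, in_dom T r t ->
    h' r t = h r t /\ U' r t = U r t /\ V' r t = V r t.

(* Main.v *)
Require Import Defs.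
From Stdlib Require Import Reals.
From Coquelicot Require Import Coquelicot.
From Stdlib Require Import Lra Psatz Classical.
Open Scope R_scope.

(** Write the solution as [(h(t) a1(r), u(t) a2(r), v(t) a3(r))] with [u a2] not
    identically zero (otherwise it is steady).

    If [v] is not constant, comparing the third equation at two times shows that
    [a3] is proportional to [a2] and that [a2' + a2 / r] is constant; the other two
    equations then force [a2] to be linear.  For [U = u r], [V = v r] the function
    [s = exp (2 int u)] satisfies [s'' + s = const], so [u = s' / (2 s)],
    [2 v + 1 = w0 / s] and [h = h0 / s^n] with [s] a trigonometric polynomial:
    the solution is [2 pi]-periodic if [s] has no zero and blows up at its first
    zero otherwise.

    If [v] is constant, then the absolute vorticity vanishes where [a2 <> 0], and the
    second equation at two radii yields either the linear profile again, or a
    steady solution, or a relation [h = g0 + g1 u^2] with [u' = - al u^2 + be].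
    Since [r (V + r / 2)] is constant in [r], the force [V + V^2 / r] decreases like
    [- r / 4]; this gives [al be < 0], so that [u] is a tangent and blows up. *)

(** Coriolis parameter 1 means a frame rotating at rate [1/2], so [V + r / 2] is the azimuthal
    velocity seen from rest. This is the origin of [2 v + 1] and of the invariant [r (V + r / 2)];
    [s] is the factor by which the area of a moving disc has grown.

    A solution lives on an arbitrary interval, so every case must produce formulas that solve the
    system beyond it. An equation at a fixed radius is a differential equation in time, and
    equations at several times or radii are linear relations whose coefficients must agree. The
    obstacle is that [a2] may vanish at some radii: the vorticity relations hold only elsewhere, so
    statements about [a2] are carried over its zeros by continuity or exploit the first one.

    The sign of [al be] is decisive: for [al be > 0] a Riccati solution can be a hyperbolic tangent,
    global and not periodic. The sign uses the whole half line of radii: either [r] tends to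
    infinity, or a zero of [a2] is reached, or an identity rational in [r] holds for all [r > 0]. *)

Definition time_dom (T : Rbar) (t : R) : Prop := 0 < t /\ Rbar_lt t T.

(** The derivative of [h U] is expanded, so that fixing [r] leaves ordinary differential equations
    in [t] and fixing [t] leaves relations between radial profiles. *)
Definition separated_system (T : Rbar) (h u v a1 a2 a3 : R -> R) : Prop :=
  (forall t, time_dom T t -> ex_derive h t /\ ex_derive u t /\ ex_derive v t) /\
  (forall r, 0 < r -> ex_derive a1 r /\ ex_derive a2 r /\ ex_derive a3 r) /\
  (forall r t, 0 < r -> time_dom T t ->
    Derive h t * a1 r
      + h t * u t * (Derive a1 r * a2 r + a1 r * Derive a2 r + a1 r * a2 r / r) = 0 /\
    Derive u t * a2 r + (u t)^2 * a2 r * Derive a2 r + h t * Derive a1 r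
      - v t * a3 r - (v t * a3 r)^2 / r = 0 /\
    Derive v t * a3 r + u t * a2 r * (v t * (Derive a3 r + a3 r / r) + 1) = 0).

Definition represents (T : Rbar) (H U V : R -> R -> R) (h u v a1 a2 a3 : R -> R) : Prop :=
  forall r t, in_dom T r t ->
    H r t = h t * a1 r /\ U r t = u t * a2 r /\ V r t = v t * a3 r.

Definition periodic_or_blowup (T : Rbar) (h U V : R -> R -> R) : Prop :=
  (exists h' U' V' : R -> R -> R,
     continuation T h U V p_infty h' U' V' /\ time_periodic h' U' V')
  \/
  (exists (Tb : R) (h' U' V' : R -> R -> R),
     continuation T h U V (Finite Tb) h' U' V' /\ blows_up_at Tb h' U' V').

(** * Calculus on intervals: constancy, locality, first zeros *)

Lemma locally_time_dom T t : time_dom T t -> locally t (time_dom T).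
Proof.
intros [h1 h2]. apply filter_and.
- now apply (open_gt 0).
- now apply open_Rbar_lt.
Qed.

Lemma time_dom_between T x y z :
  time_dom T x -> time_dom T y -> x <= z <= y -> time_dom T z.
Proof.
intros [h1 h2] [h3 h4] h5. split; [lra|].
destruct T; simpl in *; trivial; lra.
Qed.

Lemma time_dom_nonempty T : Rbar_lt 0 T -> exists t, time_dom T t.
Proof.
destruct T as [T| |]; simpl; intros h; try easy.
- exists (T / 2). split; simpl; lra.
- exists 1. split; simpl; lra.
Qed.

Lemma locally_pos r : 0 < r -> locally r (fun x => 0 < x).
Proof. intros h. now apply (open_gt 0). Qed.

Lemma locally_neq (f : R -> R) x c :
  ex_derive f x -> f x <> c -> locally x (fun y => f y <> c).
Proof.
intros hf hx. apply (ex_derive_continuous f x hf (fun y => y <> c)).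
now apply (open_neq c).
Qed.

Lemma ex_derive_continuity_pt (f : R -> R) x : ex_derive f x -> continuity_pt f x.
Proof. intros h. apply continuity_pt_filterlim. now apply (ex_derive_continuous f x). Qed.

(** The derivative vanishes only inside the segment, because the identities behind it may fail at an
    end point, such as a first zero of the radial profile. *)
Lemma constant_on_segment (f : R -> R) a b : a <= b ->
  (forall x, a <= x <= b -> ex_derive f x) ->
  (forall x, a < x < b -> Derive f x = 0) -> f a = f b.
Proof.
intros hab hex hd.
destruct (MVT_gen f a b (Derive f)) as [c [hc e]].
- rewrite Rmin_left, Rmax_right by trivial. intros x hx.
  apply Derive_correct, hex; lra.
- rewrite Rmin_left, Rmax_right by trivial. intros x hx.
  now apply ex_derive_continuity_pt, hex.
- destruct (Req_dec a b) as [->|hne]; trivial.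
  destruct (MVT_gen f a b (fun _ => 0)) as [c' [hc' e']].
  + rewrite Rmin_left, Rmax_right by trivial. intros x hx.
    rewrite <- (hd x hx). apply Derive_correct, hex; lra.
  + rewrite Rmin_left, Rmax_right by trivial. intros x hx.
    now apply ex_derive_continuity_pt, hex.
  + lra.
Qed.

Lemma constant_on_time_dom T (f : R -> R) :
  (forall t, time_dom T t -> is_derive f t 0) ->
  forall s t, time_dom T s -> time_dom T t -> f s = f t.
Proof.
intros hf.
assert (H : forall s t, s <= t -> time_dom T s -> time_dom T t -> f s = f t).
{ intros s t hst hs ht. apply constant_on_segment; trivial.
  - intros x hx. exists 0. now apply hf, time_dom_between with s t.
  - intros x hx. apply is_derive_unique, hf, time_dom_between with s t; trivial; lra. }
intros s t hs ht. destruct (Rle_dec s t); [now apply H|].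
symmetry; apply H; trivial; lra.
Qed.

Lemma Derive_locally_constant (f : R -> R) x c :
  locally x (fun y => f y = c) -> Derive f x = 0.
Proof. intros h. rewrite (Derive_ext_loc f (fun _ => c)); trivial. apply Derive_const. Qed.

(** Supplies the second time at which an equation is compared: if no nearby point changed the value,
    [f] would be locally constant. *)
Lemma Derive_neq0_moves (f : R -> R) x (P : R -> Prop) :
  Derive f x <> 0 -> locally x P -> exists y, P y /\ f y <> f x.
Proof.
intros hd hP. apply NNPP. intros hn. apply hd.
apply (Derive_locally_constant f x (f x)).
apply (filter_imp P); trivial. intros y hy.
apply NNPP. intros hne. apply hn. now exists y.
Qed.

(** The first zero is the supremum of the points up to which [f] has no zero; by continuity a
    nonzero value there would let the set extend further. *)
Lemma first_zero (f : R -> R) a :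
  (forall x, a <= x -> ex_derive f x) -> f a <> 0 ->
  (forall x, a <= x -> f x <> 0) \/
  (exists q, a < q /\ f q = 0 /\ forall x, a <= x < q -> f x <> 0).
Proof.
intros hf ha.
destruct (classic (forall x, a <= x -> f x <> 0)) as [h|h]; [now left|right].
apply not_all_ex_not in h. destruct h as [z hz].
apply imply_to_and in hz. destruct hz as [haz hz]. apply NNPP in hz.
set (E := fun x => a <= x /\ forall y, a <= y <= x -> f y <> 0).
assert (hub : forall x, E x -> x <= z).
{ intros x [h1 h2]. apply Rnot_lt_le. intros hlt. apply (h2 z); trivial; lra. }
assert (hEa : E a).
{ split; [lra|]. intros y hy. now replace y with a by lra. }
destruct (completeness E) as [q [hq1 hq2]].
{ exists z. exact hub. }
{ now exists a. }
assert (haq : a <= q) by now apply hq1.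
assert (hbelow : forall x, a <= x < q -> f x <> 0).
{ intros x hx h0.
  assert (q <= x); [|lra]. apply hq2. intros y [hy1 hy2].
  apply Rnot_lt_le. intros hlt. apply (hy2 x); trivial; lra. }
assert (hq0 : f q = 0).
{ apply NNPP. intros hne.
  destruct (locally_neq f q 0 (hf q haq) hne) as [d hd].
  assert (hE : E (q + d / 2)).
  { assert (hd0 := cond_pos d). split; [lra|]. intros y hy.
    destruct (Rlt_dec y q) as [hlt|hge]; [apply hbelow; lra|].
    apply hd. unfold ball; simpl; unfold AbsRing_ball, abs, minus, plus, opp; simpl.
    rewrite Rabs_right; lra. }
  apply hq1 in hE. assert (hd0 := cond_pos d). lra. }
exists q. repeat split; trivial.
destruct (Req_dec a q) as [e|e]; [|lra]. now rewrite e in ha.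
Qed.

(** * Passage between the fields and their profiles *)

Lemma differentiable_pt_slices f x y : differentiable_pt f x y ->
  ex_derive (fun s => f s y) x /\ ex_derive (fun s => f x s) y.
Proof.
intros [lx [ly hl]]. split.
- exists (lx * 1 + ly * 0). apply is_derive_Reals.
  apply (derivable_pt_lim_comp_2d f (fun s => s) (fun _ => y) x); trivial.
  + apply derivable_pt_lim_id.
  + apply derivable_pt_lim_const.
- exists (lx * 0 + ly * 1). apply is_derive_Reals.
  apply (derivable_pt_lim_comp_2d f (fun _ => x) (fun s => s) y); trivial.
  + apply derivable_pt_lim_const.
  + apply derivable_pt_lim_id.
Qed.

Lemma differentiable_pt_product (g a : R -> R) r t : ex_derive a r -> ex_derive g t ->
  differentiable_pt (fun r t => g t * a r) r t.
Proof.
intros [la ha] [lg hg]. apply is_derive_Reals in ha. apply is_derive_Reals in hg.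
exists (g t * la), (a r * lg).
(* The remainder of multiplication is exactly the product of the two increments, so [delta = eps]
   works. *)
assert (hm : differentiable_pt_lim (fun x y => y * x) (a r) (g t) (g t) (a r)).
{ intros eps.
  exists eps. intros x y hx hy.
  replace (y * x - g t * a r - (g t * (x - a r) + a r * (y - g t)))
    with ((x - a r) * (y - g t)) by ring.
  rewrite Rabs_mult.
  apply Rmult_le_compat; try apply Rabs_pos; [lra|apply Rmax_r]. }
assert (h1 := differentiable_pt_lim_proj1_0 a r t la ha).
assert (h2 : differentiable_pt_lim (fun _ w => g w) r t 0 lg).
{ intros eps. destruct (differentiable_pt_lim_proj1_0 g t r lg hg eps) as [d hd].
  exists d. intros x y hx hy. specialize (hd y x hy hx). rewrite Rmax_comm.
  replace (g y - g t - (0 * (x - r) + lg * (y - t)))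
    with (g y - g t - (lg * (y - t) + 0 * (x - r))) by ring. exact hd. }
assert (h3 := differentiable_pt_lim_comp _ _ _ r t _ _ _ _ _ _ hm h1 h2).
simpl in h3.
replace (g t * la) with (g t * la + a r * 0) by ring.
replace (a r * lg) with (g t * 0 + a r * lg) by ring. exact h3.
Qed.

Lemma separated_system_solution T h u v a1 a2 a3 :
  separated_system T h u v a1 a2 a3 ->
  classical_solution T (fun r t => h t * a1 r) (fun r t => u t * a2 r) (fun r t => v t * a3 r).
Proof.
intros [ht [hr heq]] r t [h0 htd].
destruct (ht t htd) as [k1 [k2 k3]]. destruct (hr r h0) as [k4 [k5 k6]].
destruct (heq r t h0 htd) as [e1 [e2 e3]].
split; [repeat split; now apply differentiable_pt_product|].
unfold dt, dr.
rewrite !Derive_scal_l, !Derive_scal.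
replace (Derive (fun s => h t * a1 s * (u t * a2 s)) r)
  with (h t * u t * (Derive a1 r * a2 r + a1 r * Derive a2 r)).
2:{ rewrite Derive_mult by (apply ex_derive_scal; trivial).
    rewrite !Derive_scal. ring. }
split; [|split].
- rewrite <- e1. field; lra.
- rewrite <- e2. field; lra.
- rewrite <- e3. field; lra.
Qed.

(** The fields agree with the products only on the open domain; this suffices because every
    derivative is local. *)
Lemma solution_separated_system T H U V h u v a1 a2 a3 :
  classical_solution T H U V -> represents T H U V h u v a1 a2 a3 ->
  (forall t, time_dom T t -> ex_derive h t /\ ex_derive u t /\ ex_derive v t) ->
  (forall r, 0 < r -> ex_derive a1 r /\ ex_derive a2 r /\ ex_derive a3 r) ->
  separated_system T h u v a1 a2 a3.
Proof.
intros hsol hrep ht hr. split; [|split]; trivial.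
intros r t h0 htd.
destruct (ht t htd) as [k1 [k2 k3]]. destruct (hr r h0) as [k4 [k5 k6]].
assert (hd : in_dom T r t) by (split; trivial).
destruct (hsol r t hd) as [_ [e1 [e2 e3]]].
destruct (hrep r t hd) as [r1 [r2 r3]].
assert (lr : forall P : R -> Prop, (forall s, 0 < s -> P s) -> locally r P).
{ intros P hP. apply (filter_imp (fun s => 0 < s)); trivial. now apply locally_pos. }
assert (lt : forall P : R -> Prop, (forall s, time_dom T s -> P s) -> locally t P).
{ intros P hP. apply (filter_imp (time_dom T)); trivial. now apply locally_time_dom. }
unfold dt, dr in *.
rewrite (Derive_ext_loc (fun s => H r s) (fun s => h s * a1 r)) in e1
  by (apply lt; intros s hs; apply hrep; split; trivial).
rewrite (Derive_ext_loc (fun s => U r s) (fun s => u s * a2 r)) in e2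
  by (apply lt; intros s hs; apply hrep; split; trivial).
rewrite (Derive_ext_loc (fun s => V r s) (fun s => v s * a3 r)) in e3
  by (apply lt; intros s hs; apply hrep; split; trivial).
rewrite (Derive_ext_loc (fun s => H s t) (fun s => h t * a1 s)) in e2
  by (apply lr; intros s hs; apply hrep; split; trivial).
rewrite (Derive_ext_loc (fun s => U s t) (fun s => u t * a2 s)) in e2
  by (apply lr; intros s hs; apply hrep; split; trivial).
rewrite (Derive_ext_loc (fun s => V s t) (fun s => v t * a3 s)) in e3
  by (apply lr; intros s hs; apply hrep; split; trivial).
rewrite (Derive_ext_loc (fun s => H s t * U s t) (fun s => h t * a1 s * (u t * a2 s))) in e1.
2:{ apply lr. intros s hs.
    assert (hd' : in_dom T s t) by (split; trivial).
    destruct (hrep s t hd') as [-> [-> _]]. reflexivity. }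
rewrite ?Derive_scal_l, ?Derive_scal, ?r1, ?r2, ?r3 in *.
rewrite Derive_mult, !Derive_scal in e1 by (apply ex_derive_scal; trivial).
split; [|split].
- rewrite <- e1. field; lra.
- rewrite <- e2. field; lra.
- rewrite <- e3. field; lra.
Qed.

(* A vanishing field is written [1 * 0], so that its time profile never vanishes. *)
Lemma differentiable_factors T (f : R -> R -> R) (g a : R -> R) :
  (forall r t, in_dom T r t -> differentiable_pt f r t) ->
  (forall r t, in_dom T r t -> f r t = g t * a r) ->
  exists g' a' : R -> R,
    (forall r t, in_dom T r t -> f r t = g' t * a' r) /\
    (forall t, time_dom T t -> ex_derive g' t) /\
    (forall r, 0 < r -> ex_derive a' r) /\
    ((exists r t, 0 < r /\ time_dom T t /\ a' r <> 0 /\ g' t <> 0) \/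
     ((forall t, g' t = 1) /\ forall r, a' r = 0)).
Proof.
intros hd hf.
destruct (classic (exists r t, in_dom T r t /\ f r t <> 0)) as [[r0 [t0 [h0 hne]]]|hz].
(* Slices through a point where [f] is nonzero inherit differentiability, which the given factors
   [g] and [a] may lack. *)
- exists (fun t => f r0 t), (fun r => f r t0 / f r0 t0).
  assert (h0' := h0). destruct h0' as [hr0 ht0].
  repeat split.
  + intros r t hrt. destruct hrt as [hr ht].
    rewrite (hf r0 t0), (hf r t), (hf r0 t), (hf r t0) by (split; assumption).
    rewrite hf in hne by trivial.
    field. split; intros e; apply hne; rewrite e; ring.
  + intros t ht. apply (differentiable_pt_slices f r0 t). apply hd. now split.
  + intros r hr. apply ex_derive_mult; [|apply ex_derive_const].
    apply (differentiable_pt_slices f r t0). apply hd. now split.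
  + left. exists r0, t0. repeat split; try apply ht0; trivial.
    replace (f r0 t0 / f r0 t0) with 1 by (field; trivial). lra.
- exists (fun _ => 1), (fun _ => 0). repeat split.
  + intros r t hrt. rewrite Rmult_0_r. apply NNPP. intros hne. apply hz. now exists r, t.
  + intros; apply ex_derive_const.
  + intros; apply ex_derive_const.
  + right. now split.
Qed.

(** * Outcomes reached from explicit profiles *)

Lemma continuation_of_profiles T T' H U V h u v a1 a2 a3 :
  Rbar_le T T' -> separated_system T' h u v a1 a2 a3 ->
  represents T H U V h u v a1 a2 a3 ->
  continuation T H U V T'
    (fun r t => h t * a1 r) (fun r t => u t * a2 r) (fun r t => v t * a3 r).
Proof.
intros hle hs hrep. split; [|split; [|split]]; trivial.
- now apply separated_system_solution.
- exists h, u, v, a1, a2, a3. intros; repeat split.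
- intros r t hd. destruct (hrep r t hd) as [-> [-> ->]]. repeat split.
Qed.

Lemma periodic_outcome T H U V h u v a1 a2 a3 P :
  separated_system p_infty h u v a1 a2 a3 -> represents T H U V h u v a1 a2 a3 ->
  0 < P -> (forall t, h (t + P) = h t /\ u (t + P) = u t /\ v (t + P) = v t) ->
  periodic_or_blowup T H U V.
Proof.
intros hs hrep hP hper. left.
eexists _, _, _. split.
- apply continuation_of_profiles; eauto. destruct T; simpl; trivial.
- exists P. split; trivial. intros r t hr ht.
  destruct (hper t) as [-> [-> ->]]. repeat split.
Qed.

(** At the radius [r0] the term [|U|] is a positive multiple of [|u|], and it alone drives the sum
    to infinity. *)
Lemma blowup_outcome T (Tb : R) H U V h u v a1 a2 a3 r0 :
  Rbar_le T Tb ->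
  separated_system Tb h u v a1 a2 a3 -> represents T H U V h u v a1 a2 a3 ->
  0 < r0 -> a2 r0 <> 0 ->
  (forall M, at_left Tb (fun t => M < Rabs (u t))) ->
  periodic_or_blowup T H U V.
Proof.
intros hle hs hrep hr0 ha hM. right.
eexists Tb, _, _, _. split.
- apply continuation_of_profiles; eauto.
- exists r0. split; trivial.
  intros Q [M hQ]. unfold filtermap.
  assert (hp := Rabs_pos_lt _ ha).
  specialize (hM (Rabs M / Rabs (a2 r0))).
  apply (filter_imp (F := at_left Tb) _ _) with (2 := hM).
  intros t ht. apply hQ.
  apply (Rmult_lt_compat_r (Rabs (a2 r0))) in ht; trivial.
  rewrite <- Rabs_mult in ht.
  replace (Rabs M / Rabs (a2 r0) * Rabs (a2 r0)) with (Rabs M) in ht by (field; lra).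
  assert (h1 := Rabs_pos (h t * a1 r0)). assert (h2 := Rabs_pos (v t * a3 r0)).
  assert (h3 := Rle_abs M). lra.
Qed.

Lemma steady_outcome T H U V h u v a1 a2 a3 :
  Rbar_lt 0 T ->
  separated_system T h u v a1 a2 a3 -> represents T H U V h u v a1 a2 a3 ->
  (forall t, time_dom T t -> Derive h t = 0 /\ Derive u t = 0 /\ Derive v t = 0) ->
  periodic_or_blowup T H U V.
Proof.
intros hT [ht [hr heq]] hrep hd.
destruct (time_dom_nonempty T hT) as [t0 h0].
assert (hc : forall t, time_dom T t -> h t = h t0 /\ u t = u t0 /\ v t = v t0).
{ intros t h1. repeat split; apply (constant_on_time_dom T); trivial; intros s hs;
  destruct (ht s hs) as [k1 [k2 k3]]; destruct (hd s hs) as [d1 [d2 d3]].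
  - rewrite <- d1; now apply Derive_correct.
  - rewrite <- d2; now apply Derive_correct.
  - rewrite <- d3; now apply Derive_correct. }
apply (periodic_outcome T H U V (fun _ => h t0) (fun _ => u t0) (fun _ => v t0) a1 a2 a3 1).
- split; [|split]; trivial.
  + intros. repeat split; apply ex_derive_const.
  + intros r t hr0 _. rewrite !Derive_const.
    destruct (hd t0 h0) as [d1 [d2 d3]]. specialize (heq r t0 hr0 h0).
    now rewrite d1, d2, d3 in heq.
- intros r t hrt. destruct (hrep r t hrt) as [-> [-> ->]].
  destruct hrt as [_ h1]. destruct (hc t h1) as [-> [-> ->]]. repeat split.
- lra.
- intros; repeat split.
Qed.

(** * Linear equations in time and the height factor *)

Ltac derive_val H :=
  match type of H with is_derive ?f ?x ?l =>
    change (Derive (fun y => f y) x) with (Derive f x);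
    try rewrite (is_derive_unique f x l H)
  end.

Lemma primitive_on_time_dom T u : (forall t, time_dom T t -> ex_derive u t) ->
  Rbar_lt 0 T -> exists Phi : R -> R, forall t, time_dom T t -> is_derive Phi t (u t).
Proof.
intros hu hT. destruct (time_dom_nonempty T hT) as [t0 h0].
exists (fun t => RInt u t0 t). intros t ht.
apply (is_derive_RInt u _ t0).
- apply (filter_imp (time_dom T)); [|now apply locally_time_dom].
  intros b hb. apply (RInt_correct u), (ex_RInt_continuous u). intros z hz.
  apply (ex_derive_continuous u), hu.
  destruct (Rle_dec t0 b) as [hle|hle].
  + rewrite Rmin_left, Rmax_right in hz by trivial. now apply time_dom_between with t0 b.
  + rewrite Rmin_right, Rmax_left in hz by lra. now apply time_dom_between with b t0.
- now apply (ex_derive_continuous u), hu.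
Qed.

(** Integrating factor: [h exp (k int u)] is constant, so a zero of [h] would spread to all
    times. *)
Lemma linear_ode_nonzero T (h u : R -> R) k s :
  (forall t, time_dom T t -> ex_derive h t /\ ex_derive u t) ->
  (forall t, time_dom T t -> Derive h t = - k * u t * h t) ->
  time_dom T s -> h s <> 0 -> forall t, time_dom T t -> h t <> 0.
Proof.
intros hex hd hs hne t ht h0.
assert (hT : Rbar_lt 0 T) by (destruct hs; now apply Rbar_lt_trans with s).
destruct (primitive_on_time_dom T u) as [Phi hPhi]; trivial; [intros; now apply hex|].
assert (hc : h s * exp (k * Phi s) = h t * exp (k * Phi t)).
{ apply (constant_on_time_dom T (fun t => h t * exp (k * Phi t))); trivial.
  intros x hx.
  replace 0 with ((- k * u x * h x) * exp (k * Phi x) + h x * (k * u x * exp (k * Phi x)))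
    by ring.
  rewrite <- (hd x hx). assert (hp := hPhi x hx).
  auto_derive.
  - split; [now apply hex|]. split; [|trivial]. eexists; exact hp.
  - derive_val hp.
    rewrite (Derive_ext (fun x => h x) h) by trivial. ring. }
rewrite h0, Rmult_0_l in hc. apply Rmult_integral in hc.
destruct hc as [hc|hc]; [tauto|]. assert (hp := exp_pos (k * Phi s)). lra.
Qed.

(** Separation of variables in the first equation: [lambda] is the quotient of the radial parts at a
    radius where [a1] is nonzero, and the time [t1], where [u] and [h] are nonzero, carries it to
    every radius. *)
Lemma height_equation T h u v a1 a2 a3 t1 :
  separated_system T h u v a1 a2 a3 -> time_dom T t1 -> u t1 <> 0 ->
  (exists r t, 0 < r /\ time_dom T t /\ a1 r <> 0 /\ h t <> 0) \/
    ((forall t, h t = 1) /\ forall r, a1 r = 0) ->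
  exists lambda,
    (forall t, time_dom T t -> h t <> 0 /\ Derive h t = - lambda * u t * h t) /\
    (forall r, 0 < r ->
      Derive a1 r * a2 r + a1 r * Derive a2 r + a1 r * a2 r / r = lambda * a1 r).
Proof.
intros [ht [hr heq]] h1 hu1 [[r0 [t0 [hr0 [ht0 [ha hh]]]]]|[hh ha]].
- set (L r := Derive a1 r * a2 r + a1 r * Derive a2 r + a1 r * a2 r / r).
  assert (hd : forall t, time_dom T t -> Derive h t = - (L r0 / a1 r0) * u t * h t).
  { intros t htd. destruct (heq r0 t hr0 htd) as [e _]. fold (L r0) in e.
    apply (Rmult_eq_reg_r (a1 r0)); trivial.
    transitivity (- (h t * u t * L r0)); [lra|field; trivial]. }
  assert (hne : forall t, time_dom T t -> h t <> 0).
  { apply (linear_ode_nonzero T h u (L r0 / a1 r0) t0); trivial.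
    intros t htd. split; now apply (ht t htd). }
  exists (L r0 / a1 r0). split.
  + intros t htd. split; auto.
  + intros r hr'. destruct (heq r t1 hr' h1) as [e _]. fold (L r) in e |- *.
    rewrite (hd t1 h1) in e. assert (hn1 := hne t1 h1).
    assert (e' : (h t1 * u t1) * (L r - (L r0 / a1 r0) * a1 r) = 0) by (rewrite <- e; ring).
    apply Rmult_integral in e'. destruct e' as [e'|e']; [|lra].
    apply Rmult_integral in e'. tauto.
(* The height vanishes: [a1 = 0] admits every [lambda], and the constant [h = 1] requires 0. *)
- exists 0. split.
  + intros t _. rewrite hh. split; [lra|].
    rewrite (Derive_ext h (fun _ => 1)) by trivial. rewrite Derive_const. ring.
  + intros r _. rewrite ha, (Derive_ext a1 (fun _ => 0)) by trivial.
    rewrite Derive_const. unfold Rdiv. ring.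
Qed.

(** * Flows whose velocity is linear in the radius *)

(** The difference from the explicit solution solves [D'' = - D] with zero data, and its energy
    [D^2 + D'^2] is conserved. *)
Lemma forced_oscillator T m (S S1 : R -> R) t0 :
  (forall t, time_dom T t -> is_derive S t (S1 t) /\ is_derive S1 t (m - S t)) ->
  time_dom T t0 -> forall t, time_dom T t ->
  S t = m + (S t0 - m) * cos (t - t0) + S1 t0 * sin (t - t0).
Proof.
intros hS h0 t ht.
set (D x := S x - (m + (S t0 - m) * cos (x - t0) + S1 t0 * sin (x - t0))).
set (D1 x := S1 x - (- (S t0 - m) * sin (x - t0) + S1 t0 * cos (x - t0))).
assert (hc : D t * D t + D1 t * D1 t = D t0 * D t0 + D1 t0 * D1 t0).
{ apply (constant_on_time_dom T (fun t => D t * D t + D1 t * D1 t)); trivial.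
  intros x hx. destruct (hS x hx) as [k1 k2].
  unfold D, D1. auto_derive.
  - repeat split; eexists; eauto.
  - derive_val k1. derive_val k2.
    ring. }
assert (hz : D t0 = 0 /\ D1 t0 = 0).
{ unfold D, D1. rewrite Rminus_diag, cos_0, sin_0. split; ring. }
destruct hz as [z1 z2]. rewrite z1, z2 in hc.
assert (D t = 0) by nra. unfold D in *. lra.
Qed.

Definition trig (m p q t0 t : R) : R := m + p * cos (t - t0) + q * sin (t - t0).
Definition trig' (p q t0 t : R) : R := - p * sin (t - t0) + q * cos (t - t0).

Lemma is_derive_trig m p q t0 t : is_derive (trig m p q t0) t (trig' p q t0 t).
Proof. unfold trig, trig'. auto_derive; trivial. unfold Rminus; ring. Qed.

Lemma is_derive_trig' m p q t0 t : is_derive (trig' p q t0) t (m - trig m p q t0 t).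
Proof. unfold trig, trig'. auto_derive; trivial. unfold Rminus; ring. Qed.

(** First integral of [s'' + s = m]; matching its constant with [w0^2 - 4 y h0] is what makes the
    momentum equation hold. *)
Lemma trig_energy m p q t0 t :
  (trig' p q t0 t)^2 = 2 * m * trig m p q t0 t - (trig m p q t0 t)^2 - (m^2 - p^2 - q^2).
Proof.
unfold trig, trig'. assert (h := sin2_cos2 (t - t0)). unfold Rsqr in h.
set (c := cos (t - t0)) in *. set (s := sin (t - t0)) in *.
assert (h' : s * s = 1 - c * c) by lra.
replace ((m + p * c + q * s)^2)
  with (m * m + p * p * c * c + q * q * (s * s) + 2*m*p*c + 2*m*q*s + 2*p*q*c*s) by ring.
replace ((- p * s + q * c)^2)
  with (p * p * (s * s) + q * q * c * c - 2*p*q*c*s) by ring.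
rewrite h'. ring.
Qed.

(** The pressure term is [y h0 r / s^n], while the energy identity absorbs it as a multiple of
    [s^(-2)]; hence [n = 2] or [y = 0]. *)
Lemma affine_system T (n : nat) h0 w0 y m (s s' a1 : R -> R) :
  (forall t, time_dom T t -> 0 < s t) ->
  (forall t, is_derive s t (s' t)) -> (forall t, is_derive s' t (m - s t)) ->
  (forall t, (s' t)^2 = 2 * m * s t - (s t)^2 - (w0^2 - 4 * y * h0)) ->
  (forall r, 0 < r -> ex_derive a1 r /\ Derive a1 r * r + 2 * a1 r = 2 * INR n * a1 r
                      /\ Derive a1 r = y * r) ->
  n = 2%nat \/ y = 0 ->
  separated_system T (fun t => h0 / (s t)^n) (fun t => s' t / (2 * s t))
    (fun t => (w0 / s t - 1) / 2) a1 (fun r => r) (fun r => r).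
Proof.
intros hpos hs hs' hen ha hn.
set (hh := fun t => h0 / (s t)^n). set (uu := fun t => s' t / (2 * s t)).
set (vv := fun t => (w0 / s t - 1) / 2).
assert (dh : forall t, time_dom T t ->
   is_derive hh t (- INR n * (s' t / s t) * hh t)).
{ intros t ht. assert (hp := hpos t ht).
  assert (hpn := pow_lt (s t) n hp).
  unfold hh. auto_derive.
  - repeat split; [eexists; apply hs|lra].
  - derive_val (hs t).
    destruct n as [|n].
    + simpl. field. lra.
    + replace (pred (S n)) with n by reflexivity. simpl pow.
      assert (hpn' := pow_lt (s t) n hp). field. lra. }
assert (du : forall t, time_dom T t ->
   is_derive uu t
     ((m - s t) / (2 * s t) - (s' t)^2 / (2 * (s t)^2))).
{ intros t ht. assert (hp := hpos t ht).
  unfold uu. auto_derive.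
  - split; [eexists; apply hs'|]. split; [eexists; apply hs|lra].
  - derive_val (hs t).
    derive_val (hs' t). field. lra. }
assert (dv : forall t, time_dom T t ->
   is_derive vv t (- w0 * s' t / (2 * (s t)^2))).
{ intros t ht. assert (hp := hpos t ht).
  unfold vv. auto_derive.
  - repeat split; [eexists; apply hs|lra].
  - derive_val (hs t). field. lra. }
split; [|split].
- intros t ht. repeat split; eexists; eauto.
- intros r hr. repeat split; try apply (ha r hr); apply ex_derive_id.
- intros r t hr ht. assert (hp := hpos t ht).
  rewrite (is_derive_unique _ _ _ (dh t ht)), (is_derive_unique _ _ _ (du t ht)),
    (is_derive_unique _ _ _ (dv t ht)), Derive_id.
  destruct (ha r hr) as [_ [e1 e2]]. unfold hh, uu, vv.
  assert (hpn := pow_lt (s t) n hp).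
  split; [|split].
  + transitivity (h0 / s t ^ n * (s' t / (2 * s t))
        * (Derive a1 r * r + 2 * a1 r - 2 * INR n * a1 r)); [field; lra|].
    rewrite e1. ring.
  + rewrite e2.
    assert (hy : h0 / (s t)^n * (y * r) = h0 * y * r / (s t)^2).
    { destruct hn as [-> | ->]; field; lra. }
    rewrite hy.
    transitivity (r / (4 * (s t)^2) *
      (2 * s t * (m - s t) - (s' t)^2 + 4 * y * h0 - w0^2 + (s t)^2)); [field; lra|].
    rewrite hen. ring.
  + field. lra.
Qed.

(* [S = exp (2 int u)] linearises the system: [S'' + S] is a constant of motion. *)
Lemma affine_profiles T (n : nat) y (h u v : R -> R) t0 :
  time_dom T t0 ->
  (forall t, time_dom T t -> ex_derive h t /\ ex_derive u t /\ ex_derive v t) ->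
  (forall t, time_dom T t -> Derive h t = - (2 * INR n) * u t * h t) ->
  (forall t, time_dom T t -> Derive v t = - u t * (2 * v t + 1)) ->
  (forall t, time_dom T t -> Derive u t = - (u t)^2 + v t + (v t)^2 - y * h t) ->
  n = 2%nat \/ y = 0 ->
  exists m p q h0 w0, m^2 - p^2 - q^2 = w0^2 - 4 * y * h0 /\
    forall t, time_dom T t ->
      0 < trig m p q t0 t /\
      h t = h0 / (trig m p q t0 t)^n /\
      u t = trig' p q t0 t / (2 * trig m p q t0 t) /\
      v t = (w0 / trig m p q t0 t - 1) / 2.
Proof.
intros h0 hex dh dv du hn.
assert (hT : Rbar_lt 0 T) by (destruct h0; now apply Rbar_lt_trans with t0).
destruct (primitive_on_time_dom T u) as [Phi hPhi]; trivial; [intros; now apply hex|].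
set (S t := exp (2 * (Phi t - Phi t0))).
set (S1 t := 2 * u t * S t).
assert (Sp : forall t, 0 < S t) by (intros; apply exp_pos).
assert (S0 : S t0 = 1) by (unfold S; rewrite Rminus_diag, Rmult_0_r; apply exp_0).
assert (dS : forall t, time_dom T t -> is_derive S t (S1 t)).
{ intros t ht. assert (hp := hPhi t ht). unfold S1, S. auto_derive.
  - eexists; exact hp.
  - derive_val hp. unfold Rminus. ring. }
assert (du' : forall t, time_dom T t -> is_derive u t (- (u t)^2 + v t + (v t)^2 - y * h t)).
{ intros t ht. rewrite <- du by trivial. now apply Derive_correct, hex. }
assert (dh' : forall t, time_dom T t -> is_derive h t (- (2 * INR n) * u t * h t)).
{ intros t ht. rewrite <- dh by trivial. now apply Derive_correct, hex. }
assert (dv' : forall t, time_dom T t -> is_derive v t (- u t * (2 * v t + 1))).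
{ intros t ht. rewrite <- dv by trivial. now apply Derive_correct, hex. }
(* [M] is [S'' + S] with [u'] eliminated; its derivative is a multiple of [(n - 2) y]. *)
set (M t := 2 * S t * ((u t)^2 + v t + (v t)^2 + / 2 - y * h t)).
assert (hM : forall t, time_dom T t -> M t = M t0).
{ intros t ht. apply (constant_on_time_dom T M); trivial. intros x hx.
  assert (e1 := dS x hx). assert (e2 := du' x hx). assert (e3 := dh' x hx).
  assert (e4 := dv' x hx).
  unfold M. auto_derive.
  - repeat split; eexists; eassumption.
  - derive_val e1. derive_val e2. derive_val e3. derive_val e4. unfold S1.
    destruct hn as [-> | ->]; simpl INR; field. }
set (m := M t0).
assert (dS1 : forall t, time_dom T t -> is_derive S1 t (m - S t)).
{ intros t ht. assert (e1 := dS t ht). assert (e2 := du' t ht).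
  unfold S1. auto_derive.
  - repeat split; eexists; eassumption.
  - derive_val e1. derive_val e2. unfold m. rewrite <- (hM t ht). unfold M, S1. field. }
set (p := S t0 - m). set (q := S1 t0).
assert (hS : forall t, time_dom T t -> S t = trig m p q t0 t).
{ intros t ht. apply (forced_oscillator T m S S1); auto. }
assert (hS1 : forall t, time_dom T t -> S1 t = trig' p q t0 t).
{ intros t ht. rewrite <- (is_derive_unique _ _ _ (dS t ht)).
  rewrite <- (is_derive_unique _ _ _ (is_derive_trig m p q t0 t)).
  apply Derive_ext_loc. apply (filter_imp (time_dom T)); [exact hS|].
  now apply locally_time_dom. }
(* Absolute vorticity [2 v + 1] is diluted in proportion to the area factor [S]. *)
assert (hv : forall t, time_dom T t -> (2 * v t + 1) * S t = (2 * v t0 + 1) * S t0).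
{ intros t ht. apply (constant_on_time_dom T (fun t => (2 * v t + 1) * S t)); trivial.
  intros x hx. assert (e1 := dS x hx). assert (e4 := dv' x hx).
  auto_derive.
  - repeat split; eexists; eassumption.
  - derive_val e1. derive_val e4. unfold S1. ring. }
assert (hh : forall t, time_dom T t -> h t * (S t)^n = h t0 * (S t0)^n).
{ intros t ht. apply (constant_on_time_dom T (fun t => h t * (S t)^n)); trivial.
  intros x hx. assert (e1 := dS x hx). assert (e3 := dh' x hx).
  auto_derive.
  - repeat split; eexists; eassumption.
  - derive_val e1. derive_val e3. unfold S1. destruct n as [|n]; [simpl; ring|].
    simpl pow. ring. }
exists m, p, q, (h t0), (2 * v t0 + 1). split.
- unfold p, q, S1, m, M. rewrite S0. field.
- intros t ht. rewrite <- hS, <- hS1 by trivial.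
  assert (hp := Sp t). repeat split; trivial.
  + apply (Rmult_eq_reg_r ((S t)^n)); [|apply Rgt_not_eq, pow_lt, hp].
    rewrite hh, S0, pow1 by trivial. field. apply Rgt_not_eq, pow_lt, hp.
  + unfold S1. field. lra.
  + apply (Rmult_eq_reg_r (2 * S t)); [|lra].
    transitivity ((2 * v t + 1) * S t - S t); [ring|]. rewrite hv, S0 by trivial.
    field. lra.
Qed.

Lemma positive_until_zero (f : R -> R) a q :
  (forall x, ex_derive f x) -> 0 < f a -> (forall x, a <= x < q -> f x <> 0) ->
  forall x, a <= x < q -> 0 < f x.
Proof.
intros hf ha hne x hx. apply Rnot_le_lt. intros hle.
destruct (IVT_gen f a x 0) as [z [hz ez]].
- intros z. now apply ex_derive_continuity_pt.
- rewrite Rmin_right, Rmax_left by lra. lra.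
- rewrite Rmin_left, Rmax_right in hz by lra. apply (hne z); trivial; lra.
Qed.

(** Where [s] is small the energy identity gives [s'^2 >= d s], so [|s'| / (2 s)] is at least of
    order [s^(-1/2)]. *)
Lemma trig_logarithmic_derivative_blowup (s s' : R -> R) m k a q :
  (forall t, is_derive s t (s' t)) ->
  (forall t, (s' t)^2 = 2 * m * s t - (s t)^2 - k) ->
  a < q -> (forall t, a <= t < q -> 0 < s t) -> s q = 0 ->
  forall M, at_left q (fun t => M < Rabs (s' t / (2 * s t))).
Proof.
intros hs hen haq hpos hq M.
assert (hk : k <= 0) by (assert (e := hen q); rewrite hq in e; nra).
(* At [q], [s'^2 = - k]: either the slope is nonzero, or the zero is a tangency and positivity of
   [s] before it forces [m > 0]. *)
assert (hm : k < 0 \/ (k = 0 /\ 0 < m)).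
{ destruct (Req_dec k 0) as [e|e]; [right|left; lra]. split; trivial.
  assert (hp := hpos a ltac:(lra)). assert (ea := hen a). subst k. nra. }
(* Near the zero, [s'^2 >= delta s] for some [delta > 0]. *)
assert (hd : exists d e, 0 < d /\ 0 < e /\ forall x, 0 < x < e -> d * x <= 2 * m * x - x^2 - k).
{ destruct hm as [hk'|[hk' hm]].
  - exists 1, (Rmin 1 (- k / (2 + 2 * Rabs m))).
    assert (h1 := Rabs_pos m).
    assert (h2 : 0 < - k / (2 + 2 * Rabs m)) by (apply Rdiv_lt_0_compat; lra).
    split; [lra|]. split; [apply Rmin_pos; lra|].
    intros x [hx0 hx1].
    assert (hx2 := Rlt_le_trans _ _ _ hx1 (Rmin_l _ _)).
    assert (hx3 := Rlt_le_trans _ _ _ hx1 (Rmin_r _ _)).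
    apply (Rmult_lt_compat_r (2 + 2 * Rabs m)) in hx3; [|lra].
    replace (- k / (2 + 2 * Rabs m) * (2 + 2 * Rabs m)) with (- k) in hx3 by (field; lra).
    assert (h4 : - Rabs m <= m) by (assert (h := Rle_abs (- m)); rewrite Rabs_Ropp in h; lra).
    nra.
  - exists m, m. repeat split; trivial. intros x hx. subst k. nra. }
destruct hd as [d [e [hd0 [he0 hde]]]].
set (M' := Rabs M + 1). assert (hM' : 1 <= M') by (unfold M'; assert (h := Rabs_pos M); lra).
assert (hM2 : M < M') by (unfold M'; assert (h := Rle_abs M); lra).
(* Below this bound [d s] exceeds [(2 M' s)^2]. *)
set (b := Rmin e (d / (4 * M'^2))).
assert (hb : 0 < b).
{ unfold b. apply Rmin_pos; trivial. apply Rdiv_lt_0_compat; nra. }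
assert (hcont : locally q (fun t => s t < b)).
{ apply (ex_derive_continuous s q (ex_intro _ _ (hs q)) (fun x => x < b)).
  apply (open_lt b). rewrite hq. exact hb. }
assert (hloc : locally q (fun t => a < t)) by now apply (open_gt a).
unfold at_left, within.
apply (filter_imp (fun t => s t < b /\ a < t)); [|now apply filter_and].
intros t [hsb hat] htq.
assert (hp := hpos t ltac:(lra)).
assert (hsb1 := Rlt_le_trans _ _ _ hsb (Rmin_l _ _)).
assert (hsb2 := Rlt_le_trans _ _ _ hsb (Rmin_r _ _)).
assert (h4 : 0 < 4 * M'^2) by nra.
apply (Rmult_lt_compat_r (4 * M'^2)) in hsb2; trivial.
replace (d / (4 * M'^2) * (4 * M'^2)) with d in hsb2 by (field; lra).
assert (h5 := hde (s t) ltac:(lra)). rewrite <- hen in h5.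
apply Rlt_trans with (1 := hM2).
unfold Rdiv. rewrite Rabs_mult, Rabs_inv, (Rabs_right (2 * s t)) by lra.
apply (Rmult_lt_reg_r (2 * s t)); [lra|].
replace (Rabs (s' t) * / (2 * s t) * (2 * s t)) with (Rabs (s' t)) by (field; lra).
rewrite <- (Rabs_right (M' * (2 * s t))) by nra.
apply Rsqr_lt_abs_0. unfold Rsqr.
apply Rlt_le_trans with (d * s t); [|lra].
replace (M' * (2 * s t) * (M' * (2 * s t))) with (s t * (4 * M'^2) * s t) by ring.
now apply Rmult_lt_compat_r.
Qed.

(** The closed formulas solve the system wherever [s > 0]. Before [t0] positivity comes from the
    given solution; after [t0] it lasts until the first zero of [s], which cannot lie inside the
    given lifespan. *)
Lemma affine_outcome T (n : nat) y H U V h u v a1 :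
  Rbar_lt 0 T ->
  separated_system T h u v a1 (fun r => r) (fun r => r) ->
  represents T H U V h u v a1 (fun r => r) (fun r => r) ->
  (forall t, time_dom T t -> Derive h t = - (2 * INR n) * u t * h t) ->
  (forall r, 0 < r -> Derive a1 r * r + 2 * a1 r = 2 * INR n * a1 r) ->
  (forall r, 0 < r -> Derive a1 r = y * r) ->
  n = 2%nat \/ y = 0 ->
  periodic_or_blowup T H U V.
Proof.
intros hT hs hrep dh ha hy hn.
destruct (time_dom_nonempty T hT) as [t0 h0].
assert (hs' := hs). destruct hs' as [hex [hexr heq]].
destruct (affine_profiles T n y h u v t0) as [m [p [q [k0 [w0 [hK hprof]]]]]]; trivial.
{ intros t ht. destruct (heq 1 t Rlt_0_1 ht) as [_ [_ e]].
  rewrite Derive_id in e. lra. }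
{ intros t ht. destruct (heq 1 t Rlt_0_1 ht) as [_ [e _]].
  rewrite Derive_id, (hy 1 Rlt_0_1) in e. lra. }
set (s := trig m p q t0) in *. set (s' := trig' p q t0) in *.
assert (ds : forall t, is_derive s t (s' t)) by (intros; apply is_derive_trig).
assert (ds' : forall t, is_derive s' t (m - s t)) by (intros; apply is_derive_trig').
assert (hen : forall t, (s' t)^2 = 2 * m * s t - (s t)^2 - (w0^2 - 4 * y * k0)).
{ intros t. rewrite <- hK. apply trig_energy. }
assert (hsp : forall t, time_dom T t -> 0 < s t) by (intros t ht; now apply (hprof t ht)).
assert (hsys : forall T', (forall t, time_dom T' t -> 0 < s t) ->
  separated_system T' (fun t => k0 / (s t)^n) (fun t => s' t / (2 * s t))
    (fun t => (w0 / s t - 1) / 2) a1 (fun r => r) (fun r => r)).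
{ intros T' hp. apply (affine_system T' n k0 w0 y m); trivial.
  intros r hr. repeat split; auto. now apply hexr. }
assert (hrep' : represents T H U V (fun t => k0 / (s t)^n) (fun t => s' t / (2 * s t))
    (fun t => (w0 / s t - 1) / 2) a1 (fun r => r) (fun r => r)).
{ intros r t hrt. destruct (hrep r t hrt) as [-> [-> ->]].
  destruct hrt as [_ ht]. destruct (hprof t ht) as [_ [e1 [e2 e3]]].
  rewrite e1, e2, e3. repeat split. }
destruct (first_zero s t0) as [hne|[Tb [hTb [hz hne]]]].
- intros x _. eexists; apply ds.
- apply Rgt_not_eq, hsp, h0.
- assert (hp : forall t, time_dom p_infty t -> 0 < s t).
  { intros t [ht _]. destruct (Rle_dec t0 t) as [hle|hlt].
    + apply (positive_until_zero s t0 (t + 1)); try lra.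
      * intros; eexists; apply ds.
      * now apply hsp.
      * intros x hx. apply hne. lra.
    + apply hsp. split; trivial. destruct h0 as [_ h0].
      apply (Rbar_lt_trans t t0 T); trivial. simpl. lra. }
  apply (periodic_outcome T H U V _ _ _ a1 (fun r => r) (fun r => r) (2 * PI)
    (hsys p_infty hp) hrep').
  + assert (hpi := PI_RGT_0). lra.
  + intros t. unfold s, s', trig, trig'.
    replace (t + 2 * PI - t0) with (t - t0 + 2 * PI) by ring.
    rewrite cos_plus, sin_plus, cos_2PI, sin_2PI.
    now rewrite !Rmult_0_r, !Rmult_1_r, Rminus_0_r, Rplus_0_r.
- assert (hpos : forall t, t0 <= t < Tb -> 0 < s t).
  { apply positive_until_zero; trivial.
    - intros; eexists; apply ds.
    - now apply hsp. }
  apply (blowup_outcome T Tb H U V (fun t => k0 / (s t)^n) (fun t => s' t / (2 * s t))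
    (fun t => (w0 / s t - 1) / 2) a1 (fun r => r) (fun r => r) 1); trivial; try lra.
  + apply Rbar_not_lt_le. intros hlt. assert (hp := hsp Tb).
    rewrite hz in hp. apply (Rlt_irrefl 0), hp. split; trivial.
    destruct h0. lra.
  + apply hsys. intros t [ht1 ht2]. simpl in ht2.
    destruct (Rle_dec t0 t) as [hle|hlt]; [apply hpos; lra|].
    apply hsp. split; trivial. destruct h0 as [_ h0].
    apply (Rbar_lt_trans t t0 T); trivial. simpl. lra.
  + apply (trig_logarithmic_derivative_blowup s s' m (w0^2 - 4 * y * k0) t0 Tb); trivial.
Qed.

(** In the momentum equation every term except [h a1'] is linear in [r], so [a1' = y r]. By the mass
    equation [a1] is then constant with [lambda = 2], or zero, or a multiple of [r^2] with
    [lambda = 4]. *)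
Lemma affine_flow_outcome T lambda H U V h u v a1 :
  Rbar_lt 0 T ->
  separated_system T h u v a1 (fun r => r) (fun r => r) ->
  represents T H U V h u v a1 (fun r => r) (fun r => r) ->
  (forall t, time_dom T t -> h t <> 0 /\ Derive h t = - lambda * u t * h t) ->
  (forall r, 0 < r -> Derive a1 r * r + a1 r * Derive (fun r => r) r + a1 r * r / r = lambda * a1 r) ->
  periodic_or_blowup T H U V.
Proof.
intros hT hs hrep dh ha.
destruct (time_dom_nonempty T hT) as [t0 h0].
assert (hs' := hs). destruct hs' as [hex [hexr heq]].
assert (ha' : forall r, 0 < r -> Derive a1 r * r + 2 * a1 r = lambda * a1 r).
{ intros r hr. rewrite <- ha by trivial. rewrite Derive_id. field. lra. }
set (y := - (Derive u t0 + (u t0)^2 - v t0 - (v t0)^2) / h t0).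
assert (hy : forall r, 0 < r -> Derive a1 r = y * r).
{ intros r hr. destruct (heq r t0 hr h0) as [_ [e _]]. rewrite Derive_id in e.
  destruct (dh t0 h0) as [hne _]. unfold y.
  apply (Rmult_eq_reg_l (h t0)); trivial.
  transitivity (- (Derive u t0 + (u t0)^2 - v t0 - (v t0)^2) * r); [|field; trivial].
  replace ((v t0 * r)^2 / r) with ((v t0)^2 * r) in e by (field; lra). lra. }
assert (hya : forall r, 0 < r -> y * r^2 = (lambda - 2) * a1 r).
{ intros r hr. assert (e := ha' r hr). rewrite hy in e by trivial. lra. }
destruct (Req_dec y 0) as [y0|y0].
- destruct (Req_dec lambda 2) as [l2|l2].
  + apply (affine_outcome T 1 y H U V h u v a1); auto.
    * intros t ht. destruct (dh t ht) as [_ ->]. simpl. rewrite l2. ring.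
    * intros r hr. rewrite ha', l2 by trivial. simpl. ring.
  + assert (a0 : forall r, 0 < r -> a1 r = 0).
    { intros r hr. assert (e := hya r hr). rewrite y0, Rmult_0_l in e. symmetry in e.
      apply Rmult_integral in e. lra. }
    assert (hu : forall t, time_dom T t -> ex_derive u t) by (intros; now apply hex).
    destruct (primitive_on_time_dom T u hu hT) as [Phi hPhi].
    (* The profile of a vanishing height is arbitrary; take the one of a uniform height. *)
    set (g t := exp (- (2) * Phi t)).
    assert (hg : forall t, time_dom T t -> is_derive g t (- (2) * u t * g t)).
    { intros t ht. assert (hp := hPhi t ht). unfold g. auto_derive.
      - eexists; exact hp.
      - derive_val hp. ring. }
    apply (affine_outcome T 1 y H U V g u v a1); auto.
    * split; [|split]; trivial.
      { intros t ht. split; [eexists; now apply hg|]. now apply hex. }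
      intros r t hr ht. destruct (heq r t hr ht) as [_ e].
      rewrite hy, y0, a0 in * by trivial.
      split; [unfold Rdiv; ring|]. split; [|apply e].
      destruct e as [e _]. lra.
    * intros r t hrt. destruct (hrep r t hrt) as [-> [-> ->]]. rewrite (a0 r) by apply hrt.
      now rewrite !Rmult_0_r.
    * intros t ht. rewrite (is_derive_unique _ _ _ (hg t ht)). simpl. ring.
    * intros r hr. rewrite hy, y0, a0 by trivial. ring.
(* Here [a1 = y r^2 / (lambda - 2)], and its slope is [y r] only if [lambda = 4]. *)
- assert (l4 : lambda = 4).
  { destruct (Req_dec lambda 2) as [l2|l2].
    - assert (e := hya 1 Rlt_0_1). rewrite l2 in e. lra.
    - assert (d : Derive a1 1 = y / (lambda - 2) * 2).
      { rewrite (Derive_ext_loc a1 (fun r => y / (lambda - 2) * r^2)).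
        - rewrite Derive_scal. f_equal. apply is_derive_unique. auto_derive; trivial. ring.
        - apply (filter_imp (fun r => 0 < r)); [|apply locally_pos; lra].
          intros r hr. apply (Rmult_eq_reg_l (lambda - 2)); [|lra].
          rewrite <- hya by trivial. field. lra. }
      rewrite (hy 1 Rlt_0_1) in d.
      apply (Rmult_eq_compat_r (lambda - 2)) in d.
      replace (y / (lambda - 2) * 2 * (lambda - 2)) with (2 * y) in d by (field; lra).
      assert (e : y * (lambda - 4) = 0) by lra. apply Rmult_integral in e. lra. }
  apply (affine_outcome T 2 y H U V h u v a1); auto.
  + intros t ht. destruct (dh t ht) as [_ ->]. simpl. rewrite l4. ring.
  + intros r hr. rewrite ha', l4 by trivial. simpl. ring.
Qed.

Lemma Derive_linear (a : R -> R) alpha r : 0 < r ->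
  (forall r, 0 < r -> a r = alpha * r) -> Derive a r = alpha.
Proof.
intros hr ha. rewrite (Derive_ext_loc a (fun x => alpha * x)).
- rewrite Derive_scal, Derive_id. ring.
- apply (filter_imp (fun x => 0 < x)); [exact ha|now apply locally_pos].
Qed.

(** The slopes [alpha] and [beta] move into the time factors, which turns [lambda] into
    [lambda / alpha]. *)
Lemma linear_profiles_outcome T lambda alpha beta H U V h u v a1 a2 a3 :
  Rbar_lt 0 T ->
  separated_system T h u v a1 a2 a3 -> represents T H U V h u v a1 a2 a3 ->
  (forall t, time_dom T t -> h t <> 0 /\ Derive h t = - lambda * u t * h t) ->
  (forall r, 0 < r ->
    Derive a1 r * a2 r + a1 r * Derive a2 r + a1 r * a2 r / r = lambda * a1 r) ->
  alpha <> 0 ->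
  (forall r, 0 < r -> a2 r = alpha * r) -> (forall r, 0 < r -> a3 r = beta * r) ->
  periodic_or_blowup T H U V.
Proof.
intros hT [hex [hexr heq]] hrep hh ha hne h2 h3.
apply (affine_flow_outcome T (lambda / alpha) H U V h (fun t => alpha * u t)
  (fun t => beta * v t) a1); trivial.
- split; [|split].
  + intros t ht. destruct (hex t ht) as [k1 [k2 k3]]. repeat split; trivial;
    now apply ex_derive_scal.
  + intros r hr. split; [now apply hexr|]. split; apply ex_derive_id.
  + intros r t hr ht. rewrite !Derive_scal, Derive_id.
    destruct (heq r t hr ht) as [e1 [e2 e3]].
    rewrite (Derive_linear a2 alpha r), h2 in e1 by trivial.
    rewrite (Derive_linear a2 alpha r), h2, h3 in e2 by trivial.
    rewrite (Derive_linear a3 beta r), h2, h3 in e3 by trivial.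
    split; [|split].
    * rewrite <- e1. field. lra.
    * rewrite <- e2. field. lra.
    * apply (Rmult_eq_reg_l alpha); [|trivial]. rewrite Rmult_0_r.
      transitivity (alpha * (Derive v t * (beta * r)
        + u t * (alpha * r) * (v t * (beta + beta * r / r) + 1))); [field; lra|].
      rewrite e3. ring.
- intros r t hrt. destruct (hrep r t hrt) as [-> [-> ->]].
  rewrite h2, h3 by apply hrt. repeat split; ring.
- intros t ht. destruct (hh t ht) as [k1 k2]. split; trivial. rewrite k2. field. trivial.
- intros r hr. assert (e := ha r hr). rewrite (Derive_linear a2 alpha r), h2 in e by trivial.
  rewrite Derive_id. apply (Rmult_eq_reg_l alpha); trivial.
  transitivity (lambda * a1 r); [|field; trivial]. rewrite <- e. field. lra.
Qed.

(** * Unsteady swirl: rigidity of the velocity profile *)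

(** The continuous quotient [a / (alpha r)] is 1 off the zeros of [a] and 0 at them, so a zero would
    make it take the value [1/2]. *)
Lemma constant_ratio_extends (a : R -> R) alpha r1 : 0 < r1 -> a r1 <> 0 ->
  (forall r, 0 < r -> ex_derive a r) ->
  (forall r, 0 < r -> a r <> 0 -> a r / r = alpha) ->
  forall r, 0 < r -> a r = alpha * r.
Proof.
intros h1 hne hex hq.
assert (hq' : forall r, 0 < r -> a r <> 0 -> a r = alpha * r).
{ intros r hr h0. rewrite <- (hq r hr h0). field. lra. }
intros r hr. apply hq'; trivial. intros h0.
assert (halpha : alpha <> 0) by (intros e; apply hne; rewrite (hq' r1 h1 hne), e; ring).
(* The substitution [r = exp x] makes the quotient continuous on the whole line. *)
destruct (IVT_gen (fun x => a (exp x) / exp x / alpha) (ln r) (ln r1) (/ 2)) as [z [_ hz]].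
- intros x. apply ex_derive_continuity_pt. assert (hp := exp_pos x).
  auto_derive. split; [now apply hex|]. split; [lra|trivial].
- rewrite !exp_ln by trivial.
  rewrite h0, (hq r1 h1 hne).
  replace (0 / r / alpha) with 0 by (unfold Rdiv; ring).
  replace (alpha / alpha) with 1 by (field; trivial).
  rewrite Rmin_left, Rmax_right; lra.
- assert (hp := exp_pos z).
  destruct (Req_dec (a (exp z)) 0) as [e|e].
  + rewrite e in hz. unfold Rdiv in hz. lra.
  + rewrite (hq _ hp e) in hz.
    replace (alpha / alpha) with 1 in hz by (field; trivial). lra.
Qed.

(** A nonconstant [X] takes infinitely many values, a quadratic has at most two roots.
    Algebraically, along [r X' = mu - 2 X]: where [mu <> 2 X], one differentiation gives
    [2 A X + B = 0], a second one [A = 0]. *)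
Lemma quadratic_flow_stationary (X : R -> R) (P : R -> Prop) A B C mu r :
  (forall x, P x -> locally x P) -> (forall x, P x -> 0 < x) ->
  (forall x, P x -> is_derive X x ((mu - 2 * X x) / x)) ->
  (forall x, P x -> A * (X x)^2 + B * X x + C = 0) ->
  A <> 0 -> P r -> X r = mu / 2.
Proof.
intros hop hpos hd hX hA hr.
assert (h1 : forall x, P x -> (2 * A * X x + B) * (mu - 2 * X x) = 0).
{ intros x hx. assert (hx0 := hpos x hx). assert (e := hd x hx).
  assert (e0 := Derive_locally_constant (fun x => A * (X x)^2 + B * X x + C) x 0
     (filter_imp _ _ hX (hop x hx))).
  apply (Rmult_eq_reg_r (/ x)); [|apply Rinv_neq_0_compat; lra].
  rewrite Rmult_0_l, <- e0. symmetry. apply is_derive_unique.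
  auto_derive; [repeat split; eexists; exact e|].
  derive_val e. field. lra. }
assert (h2 : (2 * A * (mu - 2 * X r) - 2 * (2 * A * X r + B)) * (mu - 2 * X r) = 0).
{ assert (hx0 := hpos r hr). assert (e := hd r hr).
  assert (e0 := Derive_locally_constant (fun x => (2 * A * X x + B) * (mu - 2 * X x)) r 0
     (filter_imp _ _ h1 (hop r hr))).
  apply (Rmult_eq_reg_r (/ r)); [|apply Rinv_neq_0_compat; lra].
  rewrite Rmult_0_l, <- e0. symmetry. apply is_derive_unique.
  auto_derive; [repeat split; eexists; exact e|].
  derive_val e. field. lra. }
assert (h3 := h1 r hr).
destruct (Req_dec (mu - 2 * X r) 0) as [e|e]; [lra|].
apply Rmult_integral in h3. destruct h3 as [h3|h3]; [|tauto].
rewrite h3 in h2. apply Rmult_integral in h2. destruct h2 as [h2|h2]; [|tauto].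
assert (A * (mu - 2 * X r) = 0) by lra. apply Rmult_integral in H. tauto.
Qed.

Lemma locally_nonzero_radius (a : R -> R) : (forall r, 0 < r -> ex_derive a r) ->
  forall r, 0 < r /\ a r <> 0 -> locally r (fun x => 0 < x /\ a x <> 0).
Proof.
intros hex r [hr ha]. apply filter_and; [now apply locally_pos|].
apply locally_neq; auto.
Qed.

(** Where [a <> 0], [X = a / r] solves [r X' = mu - 2 X]. If [X] differed at two such radii, the
    momentum equation would give [u^2 + w^2 = rho h] with [rho <> 0]; the other relations make [X] a
    root of a quadratic with leading coefficient [- 4 rho], so [X = mu / 2] at both radii. *)
Lemma constant_vorticity_profile_linear T lambda mu h u w a1 a r1 t1 :
  separated_system T h u w a1 a a ->
  (forall t, time_dom T t -> h t <> 0) ->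
  (forall r, 0 < r ->
    Derive a1 r * a r + a1 r * Derive a r + a1 r * a r / r = lambda * a1 r) ->
  (forall r, 0 < r -> a r <> 0 -> Derive a r = mu - a r / r) ->
  0 < r1 -> a r1 <> 0 -> time_dom T t1 -> w t1 <> 0 ->
  forall r, 0 < r -> a r = (a r1 / r1) * r.
Proof.
intros [hex [hexr heq]] hh ha1 hmu h1 hne1 ht1 hw.
assert (hexa : forall r, 0 < r -> ex_derive a r) by (intros; now apply hexr).
apply (constant_ratio_extends a (a r1 / r1) r1); trivial.
intros r2 h2 hne2. apply NNPP. intros hX.
set (X r := a r / r). set (Z r := Derive a1 r / a r). fold (X r2) (X r1) in hX.
assert (e2 : forall r t, 0 < r -> a r <> 0 -> time_dom T t ->
  Derive u t + mu * (u t)^2 - w t = ((u t)^2 + (w t)^2) * X r - h t * Z r).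
{ intros r t hr hne ht. destruct (heq r t hr ht) as [_ [e _]].
  rewrite (hmu r hr hne) in e. unfold X, Z.
  apply (Rmult_eq_reg_r (a r)); trivial.
  apply (Rplus_eq_reg_r (- ((u t ^ 2 + w t ^ 2) * (a r / r) - h t * (Derive a1 r / a r)) * a r)).
  transitivity 0; [rewrite <- e; field; lra|ring]. }
set (rho := (Z r2 - Z r1) / (X r2 - X r1)).
assert (hrho : forall t, time_dom T t -> (u t)^2 + (w t)^2 = rho * h t).
{ intros t ht. apply (Rmult_eq_reg_r (X r2 - X r1)); [|lra].
  transitivity (h t * (Z r2 - Z r1)); [|unfold rho; field; lra].
  assert (k1 := e2 r1 t h1 hne1 ht). assert (k2 := e2 r2 t h2 hne2 ht). lra. }
assert (hrho0 : rho <> 0).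
{ intros e. assert (k := hrho t1 ht1). rewrite e, Rmult_0_l in k.
  assert (0 < (w t1)^2) by (apply pow2_gt_0; trivial). nra. }
(* The momentum equation at [t1], divided by [h], becomes [Z = rho X - c]. *)
set (c := (Derive u t1 + mu * (u t1)^2 - w t1) / h t1).
assert (hZ : forall r, 0 < r -> a r <> 0 -> Derive a1 r = a r * (rho * X r - c)).
{ intros r hr hne. assert (k := e2 r t1 hr hne ht1). rewrite hrho in k by trivial.
  assert (hh1 := hh t1 ht1).
  unfold c. rewrite k. unfold Z. field. split; trivial. }
assert (hnu : forall r, 0 < r /\ a r <> 0 ->
  (a r)^2 * (rho * (a r / r) - c) - (lambda - mu) * a1 r = 0).
{ intros r [hr hne]. assert (k := ha1 r hr).
  rewrite (hmu r hr hne) in k.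
  assert (k' : Derive a1 r * a r = (lambda - mu) * a1 r) by
    (apply (Rplus_eq_reg_r (a1 r * mu)); rewrite (Rmult_minus_distr_r lambda), <- k; field; lra).
  rewrite <- k', hZ by trivial. unfold X. ring. }
assert (hdX : forall x, 0 < x /\ a x <> 0 -> is_derive X x ((mu - 2 * X x) / x)).
{ intros x [hx hne]. assert (e := Derive_correct a x (hexa x hx)). rewrite (hmu x hx hne) in e.
  unfold X. auto_derive.
  - repeat split; [now apply hexa|lra].
  - derive_val e. field. lra. }
(* Differentiating the relation between [a] and [a1], eliminating [a1'] and dividing by [a] leaves
   [X] alone. *)
assert (hP : forall x, 0 < x /\ a x <> 0 ->
  (-4 * rho) * (X x)^2 + (3 * rho * mu + 2 * c - (lambda - mu) * rho) * X x
    + ((lambda - mu) * c - 2 * mu * c) = 0).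
{ intros x hx'. assert (hx := hx'). destruct hx as [hx hne].
  assert (e := Derive_correct a x (hexa x hx)). rewrite (hmu x hx hne) in e.
  assert (f : is_derive a1 x (a x * (rho * X x - c))).
  { rewrite <- hZ by trivial. apply Derive_correct. now apply hexr. }
  assert (e0 := Derive_locally_constant
    (fun r => (a r)^2 * (rho * (a r / r) - c) - (lambda - mu) * a1 r) x 0
    (filter_imp _ _ hnu (locally_nonzero_radius a hexa x hx'))).
  apply (Rmult_eq_reg_r (a x)); trivial.
  rewrite Rmult_0_l, <- e0. symmetry. apply is_derive_unique.
  auto_derive.
  - repeat split; try (eexists; exact e); try (eexists; exact f); lra.
  - derive_val e. derive_val f. unfold X. field. lra. }
assert (hs : forall x, 0 < x /\ a x <> 0 -> X x = mu / 2).
{ intros x hx.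
  apply (quadratic_flow_stationary X (fun x => 0 < x /\ a x <> 0) _ _ _ mu x
    (locally_nonzero_radius a hexa) (fun x h => proj1 h) hdX hP); trivial. lra. }
apply hX. rewrite !hs by (split; trivial). reflexivity.
Qed.

Lemma unsteady_swirl_outcome T lambda H U V h u v a1 a2 a3 r1 r3 t1 :
  Rbar_lt 0 T ->
  separated_system T h u v a1 a2 a3 -> represents T H U V h u v a1 a2 a3 ->
  (forall t, time_dom T t -> h t <> 0 /\ Derive h t = - lambda * u t * h t) ->
  (forall r, 0 < r ->
    Derive a1 r * a2 r + a1 r * Derive a2 r + a1 r * a2 r / r = lambda * a1 r) ->
  0 < r1 -> a2 r1 <> 0 -> 0 < r3 -> a3 r3 <> 0 -> time_dom T t1 -> Derive v t1 <> 0 ->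
  periodic_or_blowup T H U V.
Proof.
intros hT hs hrep hh ha h1 hne1 h3 hne3 ht1 hv1.
assert (hs' := hs). destruct hs' as [hex [hexr heq]].
assert (hu1 : u t1 <> 0).
{ intros e. destruct (heq r3 t1 h3 ht1) as [_ [_ k]]. rewrite e in k.
  assert (k' : Derive v t1 * a3 r3 = 0) by lra. apply Rmult_integral in k'. tauto. }
destruct (Derive_neq0_moves v t1 (fun t => time_dom T t /\ u t <> 0)) as [t2 [[ht2 hu2] hv2]].
{ trivial. }
{ apply filter_and; [now apply locally_time_dom|]. apply locally_neq; trivial. now apply hex. }
(* Comparing the vorticity equation at the times [t1] and [t2]. *)
set (c := u t1 * u t2 * (v t1 - v t2)).
assert (hc : c <> 0).
{ unfold c. repeat apply Rmult_integral_contrapositive_currified; trivial. lra. }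
(* Cramer's rule for [a2] and [a2 (a3' + a3 / r)], which enter the third equation linearly; [c] is
   the determinant up to sign. *)
set (k := (Derive v t1 * u t2 * v t2 - Derive v t2 * u t1 * v t1) / c).
set (l := (Derive v t2 * u t1 - Derive v t1 * u t2) / c).
assert (hk : forall r, 0 < r -> a2 r = k * a3 r).
{ intros r hr. destruct (heq r t1 hr ht1) as [_ [_ e1]]. destruct (heq r t2 hr ht2) as [_ [_ e2]].
  apply (Rmult_eq_reg_r c); trivial.
  transitivity ((Derive v t1 * u t2 * v t2 - Derive v t2 * u t1 * v t1) * a3 r);
    [|unfold k; field; trivial].
  set (b := Derive a3 r + a3 r / r) in *. unfold c.
  apply Rminus_diag_uniq.
  transitivity (- (u t2 * v t2) *
    (Derive v t1 * a3 r + u t1 * a2 r * (v t1 * b + 1))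
    + u t1 * v t1 * (Derive v t2 * a3 r + u t2 * a2 r * (v t2 * b + 1))); [ring|].
  rewrite e1, e2. ring. }
assert (hl : forall r, 0 < r -> a2 r * (Derive a3 r + a3 r / r) = l * a3 r).
{ intros r hr. destruct (heq r t1 hr ht1) as [_ [_ e1]]. destruct (heq r t2 hr ht2) as [_ [_ e2]].
  apply (Rmult_eq_reg_r c); trivial.
  transitivity ((Derive v t2 * u t1 - Derive v t1 * u t2) * a3 r);
    [|unfold l; field; trivial].
  set (b := Derive a3 r + a3 r / r) in *. unfold c.
  apply Rminus_diag_uniq.
  transitivity (u t2 * (Derive v t1 * a3 r + u t1 * a2 r * (v t1 * b + 1))
    - u t1 * (Derive v t2 * a3 r + u t2 * a2 r * (v t2 * b + 1))); [ring|].
  rewrite e1, e2. ring. }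
assert (hk0 : k <> 0).
{ intros e. apply hne1. rewrite hk, e by trivial. ring. }
assert (h32 : forall r, 0 < r -> a3 r = / k * a2 r).
{ intros r hr. rewrite hk by trivial. field. trivial. }
assert (d32 : forall r, 0 < r -> Derive a3 r = / k * Derive a2 r).
{ intros r hr. rewrite (Derive_ext_loc a3 (fun x => / k * a2 x)); [apply Derive_scal|].
  apply (filter_imp (fun x => 0 < x)); [exact h32|now apply locally_pos]. }
assert (hv : exists t, time_dom T t /\ v t <> 0).
{ destruct (Req_dec (v t1) 0) as [e|e]; [|now exists t1]. exists t2. split; trivial. lra. }
destruct hv as [t3 [ht3 hv3]].
(* The swirl is [(v / k) a2], so both velocities share one profile, and [l] is the constant value of
   [a2' + a2 / r]. *)
assert (hlin : forall r, 0 < r -> a2 r = (a2 r1 / r1) * r).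
{ apply (constant_vorticity_profile_linear T lambda l h u (fun t => v t * / k) a1 a2 r1 t3);
    trivial.
  - split; [|split].
    + intros t ht. destruct (hex t ht) as [k1 [k2 k3]]. split; [|split]; trivial.
      apply ex_derive_mult; [trivial|apply ex_derive_const].
    + intros r hr. destruct (hexr r hr) as [k1 [k2 k3]]. now split.
    + intros r t hr ht. destruct (heq r t hr ht) as [e1 [e2 e3]].
      rewrite (h32 r hr) in e2. rewrite (d32 r hr), (h32 r hr) in e3.
      rewrite Derive_scal_l.
      split; [exact e1|]. split.
      * rewrite <- e2. field. lra.
      * rewrite <- e3. field. lra.
  - intros t ht. now apply hh.
  - intros r hr hne. assert (e := hl r hr). rewrite (d32 r hr), (h32 r hr) in e.
    apply (Rmult_eq_reg_l (/ k * a2 r)).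
    2:{ apply Rmult_integral_contrapositive_currified; trivial. now apply Rinv_neq_0_compat. }
    apply (Rplus_eq_reg_r (/ k * a2 r * (a2 r / r))).
    transitivity (a2 r * (/ k * Derive a2 r + / k * a2 r / r)); [field; lra|].
    rewrite e. field. lra.
  - unfold Rdiv. apply Rmult_integral_contrapositive_currified; trivial.
    now apply Rinv_neq_0_compat. }
apply (linear_profiles_outcome T lambda (a2 r1 / r1) (/ k * (a2 r1 / r1)) H U V h u v a1 a2 a3);
  trivial.
- unfold Rdiv. apply Rmult_integral_contrapositive_currified; trivial.
  apply Rinv_neq_0_compat. lra.
- intros r hr. rewrite (h32 r hr), (hlin r hr). ring.
Qed.

(** * Riccati equations and their continuation *)

(** Since [u' = - al (u^2 + c^2)], [u = c tan phi] with [phi] of constant speed [k]. As [atan] stays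
    below [PI / 2], the given lifespan cannot pass the time [Tb] at which [phi] reaches it. *)
Lemma riccati_increasing_blowup T (u : R -> R) al be :
  Rbar_lt 0 T -> (forall t, time_dom T t -> is_derive u t (- al * (u t)^2 + be)) ->
  al < 0 -> 0 < be ->
  exists (Tb : R) (w : R -> R), Rbar_le T Tb /\
    (forall t, time_dom Tb t -> is_derive w t (- al * (w t)^2 + be)) /\
    (forall t, time_dom T t -> w t = u t) /\
    (forall M, at_left Tb (fun t => M < Rabs (w t))).
Proof.
intros hT hu hal hbe.
destruct (time_dom_nonempty T hT) as [t0 h0].
assert (hquo : 0 < be / - al) by (apply Rdiv_lt_0_compat; lra).
set (c := sqrt (be / - al)).
assert (hc : 0 < c) by now apply sqrt_lt_R0.
assert (hcc : be = - al * (c * c)) by (unfold c; rewrite sqrt_sqrt; [field|]; lra).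
set (k := - al * c). assert (hk : 0 < k) by (unfold k; nra).
set (phi t := atan (u t0 / c) + k * (t - t0)).
assert (hphi : forall t, time_dom T t -> atan (u t / c) = phi t).
{ intros t ht.
  assert (e : atan (u t / c) - k * (t - t0) = atan (u t0 / c) - k * (t0 - t0)).
  { apply (constant_on_time_dom T (fun t => atan (u t / c) - k * (t - t0))); trivial.
    intros x hx. assert (e := hu x hx).
    auto_derive; [eexists; exact e|].
    derive_val e. unfold k. rewrite hcc. field.
    assert (hp : 0 < c ^ 2) by nra. assert (hp' := pow2_ge_0 (u x)). split; lra. }
  unfold phi. lra. }
set (Tb := t0 + (PI / 2 - atan (u t0 / c)) / k).
assert (hb0 := atan_bound (u t0 / c)).
assert (hTb : t0 < Tb).
{ unfold Tb. assert (0 < (PI / 2 - atan (u t0 / c)) / k) by (apply Rdiv_lt_0_compat; lra). lra. }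
assert (hphiTb : phi Tb = PI / 2) by (unfold phi, Tb; field; lra).
assert (hrange : forall t, time_dom Tb t -> - (PI / 2) < phi t < PI / 2).
{ intros t [ht1 ht2]. simpl in ht2. split.
  - destruct (Rle_dec t0 t) as [hle|hlt].
    + unfold phi. assert (0 <= k * (t - t0)) by (apply Rmult_le_pos; lra). lra.
    + assert (hb := atan_bound (u t / c)). rewrite <- hphi; [lra|]. split; trivial. destruct h0 as [_ h0].
      apply (Rbar_lt_trans t t0 T); trivial. simpl. lra.
  - rewrite <- hphiTb. unfold phi. assert (k * (t - t0) < k * (Tb - t0)); [|lra].
    apply Rmult_lt_compat_l; lra. }
assert (hcos : forall t, time_dom Tb t -> 0 < cos (phi t)).
{ intros t ht. apply cos_gt_0; now apply hrange. }
exists Tb, (fun t => c * (sin (phi t) / cos (phi t))).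
split; [|split; [|split]].
- apply Rbar_not_lt_le. intros hlt.
  assert (hJ : time_dom T Tb).
  { split; [|exact hlt]. destruct h0 as [h0 _]. lra. }
  assert (e := hphi Tb hJ). assert (hb := atan_bound (u Tb / c)). lra.
- intros t ht. assert (hp := hcos t ht).
  assert (hd : is_derive phi t k) by (unfold phi; auto_derive; trivial; ring).
  auto_derive.
  { split; [eexists; exact hd|]. split; [eexists; exact hd|]. split; [lra|trivial]. }
  derive_val hd. set (x := phi t) in *.
  assert (hs := sin2_cos2 x). unfold Rsqr in hs.
  rewrite hcc. unfold k.
  apply (Rmult_eq_reg_r (cos x * cos x)); [|nra].
  transitivity (- al * (c * c) * (sin x * sin x + cos x * cos x)); [field; lra|].
  field. lra.
- intros t ht. rewrite <- hphi by trivial. change (sin ?x / cos ?x) with (tan x).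
  rewrite tan_atan. field. lra.
- intros M.
  set (M' := Rabs M + 1).
  assert (hM' : M < M' /\ 1 <= M').
  { unfold M'. assert (h1 := Rle_abs M). assert (h2 := Rabs_pos M). lra. }
  (* A cosine below [1/2] makes [|sin|] at least [1/2]; below [c / (2 M')] it then makes [c |tan|]
     exceed [M']. *)
  assert (hdpos : 0 < Rmin (/ 2) (c / (2 * M'))).
  { apply Rmin_pos; [lra|]. apply Rdiv_lt_0_compat; lra. }
  assert (hl1 : locally Tb (fun t => cos (phi t) < Rmin (/ 2) (c / (2 * M')))).
  { assert (hcont : ex_derive (fun t => cos (phi t)) Tb) by (unfold phi; auto_derive; trivial).
    apply (ex_derive_continuous _ Tb hcont (fun x => x < Rmin (/ 2) (c / (2 * M')))).
    apply open_lt. rewrite hphiTb, cos_PI2. exact hdpos. }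
  assert (hl2 : locally Tb (fun t => 0 < t)).
  { apply locally_pos. destruct h0. lra. }
  unfold at_left, within.
  apply (filter_imp (fun t => cos (phi t) < Rmin (/ 2) (c / (2 * M')) /\ 0 < t));
    [|now apply filter_and].
  intros t [h1 h2] h3. assert (hp : 0 < cos (phi t)) by (apply hcos; now split).
  assert (h4 := Rlt_le_trans _ _ _ h1 (Rmin_l _ _)).
  assert (h5 := Rlt_le_trans _ _ _ h1 (Rmin_r _ _)).
  apply (Rmult_lt_compat_r (2 * M')) in h5; [|lra].
  replace (c / (2 * M') * (2 * M')) with c in h5 by (field; lra).
  assert (hs := sin2_cos2 (phi t)). unfold Rsqr in hs.
  assert (h6 : / 2 <= Rabs (sin (phi t))).
  { rewrite <- (Rabs_right (/ 2)) by lra. apply Rsqr_le_abs_0. unfold Rsqr. nra. }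
  apply Rlt_trans with M'; [tauto|].
  unfold Rdiv. rewrite !Rabs_mult, Rabs_inv, (Rabs_right c), (Rabs_right (cos _)) by lra.
  apply (Rmult_lt_reg_r (cos (phi t))); trivial.
  replace (c * (Rabs (sin (phi t)) * / cos (phi t)) * cos (phi t))
    with (c * Rabs (sin (phi t))) by (field; lra).
  nra.
Qed.

Lemma riccati_blowup T (u : R -> R) al be :
  Rbar_lt 0 T -> (forall t, time_dom T t -> is_derive u t (- al * (u t)^2 + be)) ->
  al * be < 0 ->
  exists (Tb : R) (w : R -> R), Rbar_le T Tb /\
    (forall t, time_dom Tb t -> is_derive w t (- al * (w t)^2 + be)) /\
    (forall t, time_dom T t -> w t = u t) /\
    (forall M, at_left Tb (fun t => M < Rabs (w t))).
Proof.
intros hT hu hneg.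
destruct (Rlt_dec al 0) as [hal|hal].
- apply riccati_increasing_blowup; trivial. nra.
- assert (hal' : 0 < al).
  { destruct (Req_dec al 0) as [e|e]; [rewrite e in hneg|]; lra. }
  assert (hbe : be < 0) by nra.
  destruct (riccati_increasing_blowup T (fun t => - u t) (- al) (- be))
    as [Tb [w [h1 [h2 [h3 h4]]]]]; trivial; try lra.
  + intros t ht. replace (- - al * (- u t)^2 + - be) with (- (- al * (u t)^2 + be)) by ring.
    apply (is_derive_opp u). now apply hu.
  + exists Tb, (fun t => - w t). split; [trivial|split; [|split]].
    * intros t ht. replace (- al * (- w t)^2 + be) with (- (- - al * (w t)^2 + - be)) by ring.
      apply (is_derive_opp w). now apply h2.
    * intros t ht. rewrite h3 by trivial. ring.
    * intros M. apply (filter_imp (F := at_left Tb) _ _) with (2 := h4 M).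
      intros t. now rewrite Rabs_Ropp.
Qed.

(** With [x] and [y] the values of [u^2] at two times, this splits an equation into its
    coefficients. *)
Lemma affine_two_zeros A B x y : x <> y -> A * x + B = 0 -> A * y + B = 0 -> A = 0 /\ B = 0.
Proof.
intros hne h1 h2. assert (h : A * (x - y) = 0) by lra.
apply Rmult_integral in h. destruct h as [h|h]; [|lra]. rewrite h in *. lra.
Qed.

(* The equations at a fixed radius are affine in [u^2] along the solution, so
   they persist along the continued Riccati solution. *)
Lemma riccati_outcome T al be g0 g1 v0 H U V h u v a1 a2 a3 r1 t1 t2 :
  Rbar_lt 0 T ->
  separated_system T h u v a1 a2 a3 -> represents T H U V h u v a1 a2 a3 ->
  0 < r1 -> a2 r1 <> 0 ->
  time_dom T t1 -> time_dom T t2 -> u t1 <> 0 -> u t2 <> 0 -> (u t1)^2 <> (u t2)^2 ->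
  (forall t, time_dom T t -> v t = v0) ->
  (forall t, time_dom T t -> h t = g0 + g1 * (u t)^2) ->
  (forall t, time_dom T t -> Derive u t = - al * (u t)^2 + be) ->
  al * be < 0 ->
  periodic_or_blowup T H U V.
Proof.
intros hT [hex [hexr heq]] hrep hr1 ha2 ht1 ht2 hu1 hu2 hu12 hv hh hu hneg.
assert (hu' : forall t, time_dom T t -> is_derive u t (- al * (u t)^2 + be)).
{ intros t ht. rewrite <- hu by trivial. now apply Derive_correct, hex. }
destruct (riccati_blowup T u al be hT hu' hneg) as [Tb [w [hle [hw [hwu hblow]]]]].
assert (hdh : forall t, time_dom T t -> Derive h t = 2 * g1 * u t * (- al * (u t)^2 + be)).
{ intros t ht. rewrite (Derive_ext_loc h (fun t => g0 + g1 * (u t)^2)).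
  - apply is_derive_unique. assert (e := hu' t ht).
    auto_derive; [eexists; exact e|]. derive_val e. ring.
  - apply (filter_imp (time_dom T)); [exact hh|now apply locally_time_dom]. }
assert (hdv : forall t, time_dom T t -> Derive v t = 0).
{ intros t ht. apply (Derive_locally_constant v t v0).
  apply (filter_imp (time_dom T)); [exact hv|now apply locally_time_dom]. }
apply (blowup_outcome T Tb H U V (fun t => g0 + g1 * (w t)^2) w (fun _ => v0) a1 a2 a3 r1);
  trivial.
- split; [|split]; trivial.
  + intros t ht. assert (e := hw t ht). split; [|split].
    * auto_derive. eexists; exact e.
    * eexists; exact e.
    * apply ex_derive_const.
  + intros r t hr ht. assert (e := hw t ht).
    replace (Derive (fun t => g0 + g1 * (w t)^2) t)
      with (2 * g1 * w t * (- al * (w t)^2 + be)).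
    2:{ symmetry. apply is_derive_unique. auto_derive; [eexists; exact e|].
        derive_val e. ring. }
    rewrite Derive_const, (is_derive_unique _ _ _ e).
    set (L := Derive a1 r * a2 r + a1 r * Derive a2 r + a1 r * a2 r / r).
    assert (k1 : forall s, time_dom T s -> u s <> 0 ->
      (-2 * g1 * al * a1 r + g1 * L) * (u s)^2 + (2 * g1 * be * a1 r + g0 * L) = 0).
    { intros s hs hne. destruct (heq r s hr hs) as [k _].
      rewrite hdh, hh in k by trivial. fold L in k.
      apply (Rmult_eq_reg_l (u s)); trivial. rewrite Rmult_0_r, <- k. ring. }
    assert (k2 : forall s, time_dom T s ->
      (- al * a2 r + a2 r * Derive a2 r + g1 * Derive a1 r) * (u s)^2
        + (be * a2 r + g0 * Derive a1 r - v0 * a3 r - (v0 * a3 r)^2 / r) = 0).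
    { intros s hs. destruct (heq r s hr hs) as [_ [k _]].
      rewrite hu, hh, hv in k by trivial. rewrite <- k. ring. }
    destruct (affine_two_zeros _ _ _ _ hu12 (k1 t1 ht1 hu1) (k1 t2 ht2 hu2)) as [l1 l2].
    destruct (affine_two_zeros _ _ _ _ hu12 (k2 t1 ht1) (k2 t2 ht2)) as [l3 l4].
    split; [|split].
    * transitivity (w t * ((-2 * g1 * al * a1 r + g1 * L) * (w t)^2
        + (2 * g1 * be * a1 r + g0 * L))); [ring|]. rewrite l1, l2. ring.
    * transitivity ((- al * a2 r + a2 r * Derive a2 r + g1 * Derive a1 r) * (w t)^2
        + (be * a2 r + g0 * Derive a1 r - v0 * a3 r - (v0 * a3 r)^2 / r)); [ring|].
      rewrite l3, l4. ring.
    * destruct (heq r t1 hr ht1) as [_ [_ k]]. rewrite hdv, hv in k by trivial.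
      rewrite Rmult_0_l, Rplus_0_l, Rmult_assoc in k.
      apply Rmult_integral in k. destruct k as [k|k]; [tauto|].
      rewrite Rmult_assoc, k. ring.
- intros r t hrt. destruct (hrep r t hrt) as [-> [-> ->]]. destruct hrt as [_ ht].
  rewrite hh, hv, hwu by trivial. repeat split.
Qed.

(** * Steady swirl: balances of forces and the sign of [al be] *)

Lemma constant_on_half_line (f : R -> R) :
  (forall r, 0 < r -> is_derive f r 0) -> forall r s, 0 < r -> 0 < s -> f r = f s.
Proof.
intros hf r s hr hs. apply (constant_on_time_dom p_infty f); [|now split|now split].
intros x [hx _]. now apply hf.
Qed.

(* [b] is the azimuthal velocity and [b + b^2 / r] the resulting force; where the
   fluid moves radially the absolute vorticity [b' + b / r + 1] vanishes.  Then
   [E a^2 + r^2 / 4 + (b + r / 2)^2] and [r (b + r / 2)] are both constant. *)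
Lemma steady_momentum_coefficient_negative (a b : R -> R) E r1 :
  (forall r, 0 < r -> ex_derive a r) -> (forall r, 0 < r -> ex_derive b r) ->
  (forall r, 0 < r -> a r <> 0 -> Derive b r = - 1 - b r / r) ->
  (forall r, 0 < r -> E * (a r * Derive a r) = b r + (b r)^2 / r) ->
  0 < r1 -> a r1 <> 0 -> E < 0.
Proof.
intros hexa hexb hb hG hr1 hne. apply Rnot_le_lt. intros hE.
set (F r := E * (a r)^2 + r^2 / 4 + (b r + r / 2)^2).
set (K r := r * (b r + r / 2)).
assert (exF : forall r, 0 < r -> ex_derive F r).
{ intros r hr. unfold F. auto_derive. repeat apply conj; auto. }
assert (exK : forall r, 0 < r -> ex_derive K r).
{ intros r hr. unfold K. auto_derive. auto. }
assert (dF : forall r, 0 < r -> a r <> 0 -> Derive F r = 0).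
{ intros r hr h0. assert (ea := Derive_correct a r (hexa r hr)).
  assert (eb := Derive_correct b r (hexb r hr)). rewrite (hb r hr h0) in eb.
  apply is_derive_unique. unfold F. auto_derive.
  - repeat apply conj; auto.
  - derive_val ea. derive_val eb.
    transitivity (2 * (E * (a r * Derive a r)) - 2 * (b r + (b r)^2 / r)); [field; lra|].
    rewrite hG by trivial. ring. }
assert (dK : forall r, 0 < r -> a r <> 0 -> Derive K r = 0).
{ intros r hr h0.
  assert (eb := Derive_correct b r (hexb r hr)). rewrite (hb r hr h0) in eb.
  apply is_derive_unique. unfold K. auto_derive.
  - auto.
  - derive_val eb. field. lra. }
assert (hFlow : forall r, r^2 / 4 <= F r).
{ intros r. unfold F. assert (h1 := pow2_ge_0 (a r)). assert (h2 := pow2_ge_0 (b r + r / 2)).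
  assert (h3 : 0 <= E * (a r)^2) by now apply Rmult_le_pos. lra. }
destruct (first_zero a r1) as [hnz|[q [hq [hz hnz]]]]; trivial.
- intros x hx. apply hexa. lra.
(* Without a zero beyond [r1], [F] is constant there, but at [x] its lower bound [x^2 / 4] exceeds
   [F r1]. *)
- assert (hF0 := hFlow r1). assert (hsq := pow2_ge_0 r1).
  set (x := r1 + F r1 + 4).
  assert (e : F r1 = F x).
  { apply constant_on_segment; [unfold x; lra| |].
    - intros y hy. apply exF. lra.
    - intros y hy. apply dF; [lra|]. apply hnz. lra. }
  assert (hx := hFlow x). rewrite <- e in hx. unfold x in hx. nra.
(* At the first zero [q] the force vanishes, so [(b q + q / 2)^2 = q^2 / 4]. Carrying [F] and [K]
   back to [r1] gives [r1^2 E a(r1)^2 + (r1^2 - q^2)^2 / 4 = 0], impossible for [E >= 0]. *)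
- assert (eF : F r1 = F q).
  { apply constant_on_segment; [lra| |].
    - intros y hy. apply exF. lra.
    - intros y hy. apply dF; [lra|]. apply hnz. lra. }
  assert (eK : K r1 = K q).
  { apply constant_on_segment; [lra| |].
    - intros y hy. apply exK. lra.
    - intros y hy. apply dK; [lra|]. apply hnz. lra. }
  assert (hGq := hG q ltac:(lra)). rewrite hz in hGq.
  assert (hbq : (b q + q / 2)^2 = q^2 / 4).
  { transitivity (q * (b q + (b q)^2 / q) + q^2 / 4); [field; lra|].
    rewrite <- hGq. field. }
  assert (hb1 : r1^2 * (b r1 + r1 / 2)^2 = q^4 / 4).
  { transitivity ((K r1)^2); [unfold K; ring|]. rewrite eK. unfold K.
    transitivity (q^2 * (b q + q / 2)^2); [ring|]. rewrite hbq. field. }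
  unfold F in eF. rewrite hz, hbq in eF.
  assert (h1 : 0 <= r1^2 * (E * (a r1)^2)).
  { apply Rmult_le_pos; [apply pow2_ge_0|]. apply Rmult_le_pos; trivial. apply pow2_ge_0. }
  assert (h2 : r1^2 * (E * (a r1)^2) + (r1^2 - q^2)^2 / 4 = 0).
  { apply (Rmult_eq_compat_l (r1^2)) in eF.
    transitivity (r1 ^ 2 * (E * a r1 ^ 2 + r1 ^ 2 / 4 + (b r1 + r1 / 2) ^ 2)
      - r1^2 * (b r1 + r1 / 2)^2 + q^4 / 4 - r1^2 * (q^2 / 2)); [field|].
    rewrite eF, hb1. field. }
  assert (h3 : 0 < (r1^2 - q^2)^2) by (apply pow2_gt_0; nra).
  lra.
Qed.

(** Where the absolute vorticity vanishes, [G = b + b^2 / r] satisfies [G' = - 1 - 3 G / r]. With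
    [G = g a] and [a' = al] this makes [a / r] a constant [xi]; then [g xi = - 1/4], whence
    [(b + r / 2)^2 = 0]. *)
Lemma balanced_profile_linear (a b : R -> R) al g r1 :
  (forall r, 0 < r -> ex_derive a r) -> (forall r, 0 < r -> ex_derive b r) ->
  (forall r, 0 < r -> a r <> 0 -> Derive b r = - 1 - b r / r) ->
  (forall r, 0 < r -> a r <> 0 -> Derive a r = al) ->
  (forall r, 0 < r -> a r <> 0 -> b r + (b r)^2 / r = g * a r) ->
  0 < r1 -> a r1 <> 0 ->
  exists xi, xi <> 0 /\ (forall r, 0 < r -> a r = xi * r) /\
    (forall r, 0 < r -> b r = - r / 2).
Proof.
intros hexa hexb hb ha hG hr1 hne.
assert (hg : forall r, 0 < r -> a r <> 0 -> g * al = - 1 - 3 * (g * (a r / r))).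
{ intros r hr h0. assert (ea := Derive_correct a r (hexa r hr)). rewrite (ha r hr h0) in ea.
  assert (eb := Derive_correct b r (hexb r hr)). rewrite (hb r hr h0) in eb.
  assert (e : Derive (fun x => b x + (b x)^2 / x - g * a x) r = 0).
  { apply (Derive_locally_constant _ r 0).
    apply (filter_imp (fun x => 0 < x /\ a x <> 0)); [|apply locally_nonzero_radius; auto].
    intros x [hx1 hx2]. rewrite hG by trivial. ring. }
  assert (k : - 1 - 3 * (b r + (b r)^2 / r) / r - g * al = 0).
  { rewrite <- e. symmetry. apply is_derive_unique. auto_derive.
    - repeat apply conj; auto; lra.
    - derive_val ea. derive_val eb. field. lra. }
  rewrite hG in k by trivial.
  replace (g * (a r / r)) with (g * a r / r) by (field; lra). lra. }
assert (g0 : g <> 0).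
{ intros e. assert (k := hg r1 hr1 hne). rewrite e in k. lra. }
set (xi := a r1 / r1).
assert (hlin : forall r, 0 < r -> a r = xi * r).
{ apply (constant_ratio_extends a xi r1); trivial.
  intros r hr h0. apply (Rmult_eq_reg_l g); trivial.
  assert (k1 := hg r hr h0). assert (k2 := hg r1 hr1 hne). fold xi in k2. lra. }
assert (xi0 : xi <> 0).
{ intros e. apply hne. rewrite hlin, e by trivial. ring. }
exists xi. split; [trivial|split; trivial].
intros r hr.
assert (hne' : a r <> 0).
{ rewrite hlin by trivial. apply Rmult_integral_contrapositive_currified; lra. }
assert (k := hg r hr hne'). rewrite <- (ha r hr hne'), (Derive_linear a xi r hr hlin) in k.
rewrite hlin in k by trivial.
replace (xi * r / r) with xi in k by (field; lra).
assert (e := hG r hr hne'). rewrite hlin in e by trivial.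
assert (k' : (b r + r / 2)^2 = 0).
{ transitivity (r * (b r + (b r)^2 / r) + r^2 / 4); [field; lra|].
  rewrite e. transitivity (r^2 * (g * xi + / 4)); [field|].
  replace (g * xi) with (- / 4) by lra. ring. }
assert (b r + r / 2 = 0) by (apply Rsqr_0_uniq; unfold Rsqr; lra). lra.
Qed.

(** Values at seven points determine the seven coefficients. *)
Lemma sextic_zero_on_half_line c0 c1 c2 c3 c4 c5 c6 :
  (forall r, 0 < r -> c0 + c1 * r + c2 * r^2 + c3 * r^3 + c4 * r^4 + c5 * r^5 + c6 * r^6 = 0) ->
  c4 = 0 /\ c6 = 0.
Proof.
intros h.
assert (h1 := h 1 ltac:(lra)). assert (h2 := h 2 ltac:(lra)). assert (h3 := h 3 ltac:(lra)).
assert (h4 := h 4 ltac:(lra)). assert (h5 := h 5 ltac:(lra)). assert (h6 := h 6 ltac:(lra)).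
assert (h7 := h 7 ltac:(lra)). clear h. split; lra.
Qed.

(** The flux [r a1 a] is constant. A zero of [a] would force [a1 = 0] wherever [a <> 0], and the
    balanced profile is linear without zeros. Otherwise [a = al r + b0], [b = C / r - r / 2],
    [a1 = D / (r a)], and clearing denominators gives a sextic identity: its [r^4] coefficient
    excludes [al = 0], its [r^6] coefficient yields [al be = - 1/4]. *)
Lemma steady_height_riccati_sign (a a1 b : R -> R) al be k r1 :
  (forall r, 0 < r -> ex_derive a r) -> (forall r, 0 < r -> ex_derive b r) ->
  (forall r, 0 < r -> ex_derive a1 r) ->
  (forall r, 0 < r -> a r <> 0 -> Derive b r = - 1 - b r / r) ->
  (forall r, 0 < r -> a r <> 0 -> Derive a r = al) ->
  (forall r, 0 < r -> a r <> 0 -> b r + (b r)^2 / r = be * a r + k * Derive a1 r) ->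
  (forall r, 0 < r -> Derive a1 r * a r + a1 r * Derive a r + a1 r * a r / r = 0) ->
  0 < r1 -> a r1 <> 0 -> al * be < 0.
Proof.
intros hexa hexb hexa1 hb ha hG hflux hr1 hne.
assert (hD : forall r, 0 < r -> r * a1 r * a r = r1 * a1 r1 * a r1).
{ intros r hr. apply (constant_on_half_line (fun r => r * a1 r * a r)); trivial.
  intros x hx. assert (ea := Derive_correct a x (hexa x hx)).
  assert (e1 := Derive_correct a1 x (hexa1 x hx)).
  auto_derive.
  - repeat apply conj; auto.
  - derive_val ea. derive_val e1. rewrite <- (Rmult_0_r x), <- (hflux x hx). field. lra. }
destruct (classic (exists q, 0 < q /\ a q = 0)) as [[q [hq hz]]|hnz].
- exfalso.
  assert (hD0 : r1 * a1 r1 * a r1 = 0) by (rewrite <- (hD q hq), hz; ring).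
  assert (h1 : forall r, 0 < r /\ a r <> 0 -> a1 r = 0).
  { intros r [hr h0]. assert (e := hD r hr). rewrite hD0 in e.
    apply Rmult_integral in e. destruct e as [e|e]; [|tauto].
    apply Rmult_integral in e. lra. }
  destruct (balanced_profile_linear a b al be r1) as [xi [hxi [hlin _]]]; trivial.
  + intros r hr h0. rewrite hG by trivial.
    rewrite (Derive_locally_constant a1 r 0); [ring|].
    apply (filter_imp (fun x => 0 < x /\ a x <> 0)); [exact h1|].
    now apply locally_nonzero_radius.
  + rewrite hlin in hz by trivial. apply Rmult_integral in hz. lra.
- assert (hnz' : forall r, 0 < r -> a r <> 0).
  { intros r hr e. apply hnz. now exists r. }
  set (b0 := a r1 - al * r1).
  assert (hlin : forall r, 0 < r -> a r = al * r + b0).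
  { intros r hr. assert (e : a r - al * r = b0); [|lra].
    apply (constant_on_half_line (fun r => a r - al * r)); trivial.
    intros x hx. assert (ea := Derive_correct a x (hexa x hx)).
    rewrite (ha x hx (hnz' x hx)) in ea.
    auto_derive; [now apply hexa|]. derive_val ea. ring. }
  set (C := r1 * (b r1 + r1 / 2)). set (D := r1 * a1 r1 * a r1) in *.
  assert (hC : forall r, 0 < r -> r * (b r + r / 2) = C).
  { intros r hr. apply (constant_on_half_line (fun r => r * (b r + r / 2))); trivial.
    intros x hx. assert (eb := Derive_correct b x (hexb x hx)).
    rewrite (hb x hx (hnz' x hx)) in eb.
    auto_derive; [now apply hexb|]. derive_val eb. field. lra. }
  destruct (sextic_zero_on_half_line (C^2 * b0^2) (2 * C^2 * al * b0 + k * D * b0)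
    (C^2 * al^2 + 2 * k * D * al) (- be * b0^3) (- b0^2 / 4 - 3 * be * al * b0^2)
    (- al * b0 / 2 - 3 * be * al^2 * b0) (- al^2 / 4 - be * al^3)) as [e4 e6].
  + intros r hr. assert (h0 := hnz' r hr).
    assert (eG := hG r hr h0). assert (eF := hflux r hr). rewrite (ha r hr h0) in eF.
    assert (eD := hD r hr). assert (eC := hC r hr). assert (eL := hlin r hr).
    transitivity ((C^2 - r^4 / 4) * (a r)^2 + k * D * (al * r^2 + a r * r)
      - be * (a r)^3 * r^3); [rewrite eL; field|].
    rewrite <- eC, <- eD.
    transitivity (r^3 * (a r)^2 * ((b r + (b r)^2 / r) - be * a r - k * Derive a1 r)
      + k * r^3 * a r * (Derive a1 r * a r + a1 r * al + a1 r * a r / r)); [field; lra|].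
    rewrite eG, eF. ring.
  + assert (hal : al <> 0).
    { intros e. rewrite e in e4. assert (e' : b0 * b0 = 0) by lra.
      apply Rmult_integral in e'. apply hne. rewrite hlin, e by trivial. lra. }
    assert (e : al^2 * (/ 4 + al * be) = 0) by lra.
    apply Rmult_integral in e. destruct e as [e|e]; [|lra].
    exfalso. apply (pow_nonzero al 2 hal e).
Qed.

Lemma steady_swirl_outcome T lambda H U V h u v a1 a2 a3 r1 t1 :
  Rbar_lt 0 T ->
  separated_system T h u v a1 a2 a3 -> represents T H U V h u v a1 a2 a3 ->
  (forall t, time_dom T t -> h t <> 0 /\ Derive h t = - lambda * u t * h t) ->
  (forall r, 0 < r ->
    Derive a1 r * a2 r + a1 r * Derive a2 r + a1 r * a2 r / r = lambda * a1 r) ->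
  0 < r1 -> a2 r1 <> 0 -> time_dom T t1 -> u t1 <> 0 ->
  (forall t, time_dom T t -> Derive v t = 0) ->
  periodic_or_blowup T H U V.
Proof.
intros hT hs hrep hh hflux hr1 hne1 ht1 hu1 hdv.
assert (hs' := hs). destruct hs' as [hex [hexr heq]].
set (v0 := v t1). set (b r := v0 * a3 r).
assert (hv : forall t, time_dom T t -> v t = v0).
{ intros t ht. apply (constant_on_time_dom T); trivial.
  intros s hst. rewrite <- (hdv s hst). now apply Derive_correct, hex. }
assert (hexb : forall r, 0 < r -> ex_derive b r).
{ intros r hr. apply ex_derive_scal. now apply hexr. }
assert (hexa : forall r, 0 < r -> ex_derive a2 r) by (intros; now apply hexr).
assert (hexa1 : forall r, 0 < r -> ex_derive a1 r) by (intros; now apply hexr).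
assert (hb : forall r, 0 < r -> a2 r <> 0 -> Derive b r = - 1 - b r / r).
{ intros r hr hne. destruct (heq r t1 hr ht1) as [_ [_ e]].
  rewrite hdv, Rmult_0_l, Rplus_0_l in e by trivial.
  apply Rmult_integral in e. destruct e as [e|e].
  - apply Rmult_integral in e. tauto.
  - unfold b. rewrite Derive_scal. fold v0 in e.
    apply (Rplus_eq_reg_r (1 + v0 * a3 r / r)).
    transitivity (v0 * (Derive a3 r + a3 r / r) + 1); [field; lra|]. rewrite e. field. lra. }
assert (hmom : forall r t, 0 < r -> time_dom T t ->
  Derive u t * a2 r + (u t)^2 * (a2 r * Derive a2 r) + h t * Derive a1 r = b r + (b r)^2 / r).
{ intros r t hr ht. destruct (heq r t hr ht) as [_ [e _]]. rewrite hv in e by trivial.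
  unfold b. lra. }
destruct (classic (exists t, time_dom T t /\ u t * Derive u t <> 0)) as [[ta [hta hua]]|hno].
(* Here [u] is a nonzero constant. Two different values of [h] would give [a1' = 0], making [u^2]
   the coefficient of a balance that admits only negative ones. *)
2:{ assert (hsq : forall t, time_dom T t -> (u t)^2 = (u t1)^2).
  { intros t ht. apply (constant_on_time_dom T (fun t => (u t)^2)); trivial.
    intros s hst. assert (e := Derive_correct u s (proj1 (proj2 (hex s hst)))).
    auto_derive; [now apply hex|]. change (Derive (fun y => u y) s) with (Derive u s).
    assert (k : u s * Derive u s = 0) by (apply NNPP; intros k; apply hno; now exists s).
    lra. }
  assert (hdu : forall t, time_dom T t -> Derive u t = 0).
  { intros t ht. apply NNPP. intros k. apply hno. exists t. split; trivial.
    apply Rmult_integral_contrapositive_currified; trivial. intros e.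
    assert (k' := hsq t ht). rewrite e in k'. apply (pow_nonzero (u t1) 2 hu1). lra. }
  destruct (classic (exists t, time_dom T t /\ Derive h t <> 0)) as [[t2 [ht2 hdh]]|hst].
  - exfalso.
    destruct (Derive_neq0_moves h t2 (time_dom T) hdh (locally_time_dom T t2 ht2))
      as [t3 [ht3 hne]].
    assert (hd1 : forall r, 0 < r -> Derive a1 r = 0).
    { intros r hr. assert (k2 := hmom r t2 hr ht2). assert (k3 := hmom r t3 hr ht3).
      rewrite hdu, hsq in k2, k3 by trivial.
      assert (k : (h t3 - h t2) * Derive a1 r = 0) by lra.
      apply Rmult_integral in k. destruct k as [k|k]; lra. }
    assert (hneg : (u t1)^2 < 0).
    { apply (steady_momentum_coefficient_negative a2 b ((u t1)^2) r1); trivial.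
      intros r hr. rewrite <- (hmom r t1 hr ht1), hdu, hd1 by trivial. ring. }
    assert (k := pow2_ge_0 (u t1)). lra.
  - apply (steady_outcome T H U V h u v a1 a2 a3); trivial.
    intros t ht. split; [|split]; auto.
    apply NNPP. intros k. apply hst. now exists t. }
assert (hua0 : u ta <> 0) by (intros e; apply hua; rewrite e; ring).
destruct (Derive_neq0_moves (fun t => (u t)^2) ta (fun t => time_dom T t /\ u t <> 0))
  as [tb [[htb hub0] hab]].
{ intros e. apply hua.
  replace (Derive (fun t => (u t)^2) ta) with (2 * (u ta * Derive u ta)) in e; [lra|].
  symmetry. apply is_derive_unique. auto_derive; [now apply hex|].
  change (Derive (fun y => u y) ta) with (Derive u ta). ring. }
{ apply filter_and; [now apply locally_time_dom|]. apply locally_neq; trivial. now apply hex. }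
simpl in hab.
assert (hab' : (u ta)^2 <> (u tb)^2) by (intros e; apply hab; lra). clear hab.
set (p r := Derive a2 r). set (q r := Derive a1 r / a2 r). set (g r := (b r + (b r)^2 / r) / a2 r).
assert (hpq : forall r t, 0 < r -> a2 r <> 0 -> time_dom T t ->
  Derive u t = g r - (u t)^2 * p r - h t * q r).
{ intros r t hr hne ht. unfold g, p, q. rewrite <- (hmom r t hr ht). field. trivial. }
destruct (classic (forall r, 0 < r -> a2 r <> 0 -> p r = p r1 /\ q r = q r1 /\ g r = g r1))
  as [hc|hc].
{ destruct (balanced_profile_linear a2 b (p r1) (g r1) r1) as [xi [hxi [hlin hbl]]]; trivial.
  - intros r hr hne. now apply hc.
  - intros r hr hne. destruct (hc r hr hne) as [_ [_ <-]]. unfold g. field. split; [lra|trivial].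
  - assert (hv0 : v0 <> 0).
    { intros e. assert (k := hbl 1 Rlt_0_1). unfold b in k. rewrite e in k. lra. }
    apply (linear_profiles_outcome T lambda xi (- / (2 * v0)) H U V h u v a1 a2 a3); trivial.
    intros r hr. assert (k := hbl r hr). unfold b in k.
    apply (Rmult_eq_reg_l v0); trivial. rewrite k. field. trivial. }
apply not_all_ex_not in hc. destruct hc as [r2 hc].
apply imply_to_and in hc. destruct hc as [hr2 hc].
apply imply_to_and in hc. destruct hc as [hne2 hc].
assert (hdiff : forall r t, 0 < r -> a2 r <> 0 -> time_dom T t ->
  (u t)^2 * (p r - p r1) + h t * (q r - q r1) = g r - g r1).
{ intros r t hr hne ht. assert (k1 := hpq r t hr hne ht).
  assert (k2 := hpq r1 t hr1 hne1 ht). lra. }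
(* If [q] agreed at both radii, two values of [u^2] would make [p] and [g] agree as well. *)
assert (hq : q r2 - q r1 <> 0).
{ intros e.
  assert (k1 := hdiff r2 ta hr2 hne2 hta). assert (k2 := hdiff r2 tb hr2 hne2 htb).
  rewrite e in k1, k2.
  destruct (affine_two_zeros (p r2 - p r1) (- (g r2 - g r1)) _ _ hab') as [l1 l2]; [lra|lra|].
  apply hc. repeat split; lra. }
set (g0 := (g r2 - g r1) / (q r2 - q r1)). set (g1 := - (p r2 - p r1) / (q r2 - q r1)).
assert (hh' : forall t, time_dom T t -> h t = g0 + g1 * (u t)^2).
{ intros t ht. unfold g0, g1. rewrite <- (hdiff r2 t hr2 hne2 ht). field. trivial. }
set (al := p r1 + q r1 * g1). set (be := g r1 - q r1 * g0).
assert (hdu : forall t, time_dom T t -> Derive u t = - al * (u t)^2 + be).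
{ intros t ht. rewrite (hpq r1 t hr1 hne1 ht), hh' by trivial. unfold al, be. ring. }
assert (hdh : forall t, time_dom T t -> Derive h t = 2 * g1 * u t * (- al * (u t)^2 + be)).
{ intros t ht. rewrite (Derive_ext_loc h (fun t => g0 + g1 * (u t)^2)).
  - apply is_derive_unique. auto_derive; [now apply hex|].
    change (Derive (fun y => u y) t) with (Derive u t). rewrite hdu by trivial. ring.
  - apply (filter_imp (time_dom T)); [exact hh'|now apply locally_time_dom]. }
assert (hlam : (lambda - 2 * al) * g1 = 0 /\ 2 * g1 * be + lambda * g0 = 0).
{ apply (affine_two_zeros _ _ _ _ hab').
  - apply (Rmult_eq_reg_l (u ta)); trivial. destruct (hh ta hta) as [_ k].
    rewrite hdh, hh' in k by trivial. lra.
  - apply (Rmult_eq_reg_l (u tb)); trivial. destruct (hh tb htb) as [_ k].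
    rewrite hdh, hh' in k by trivial. lra. }
destruct hlam as [hlam1 hlam2].
apply (riccati_outcome T al be g0 g1 v0 H U V h u v a1 a2 a3 r1 ta tb); trivial.
(* It remains to see [al be < 0]. For [g1 = 0] the height is constant in time, so [lambda = 0]. *)
destruct (Req_dec g1 0) as [e1|e1].
- assert (hg0 : g0 <> 0).
  { intros e. destruct (hh ta hta) as [k _]. apply k. rewrite hh', e, e1 by trivial. ring. }
  assert (hl0 : lambda = 0).
  { rewrite e1 in hlam2. assert (k : lambda * g0 = 0) by lra.
    apply Rmult_integral in k. tauto. }
  assert (hrad : forall r, 0 < r -> a2 r <> 0 -> p r = p r1 /\ g r - g0 * q r = be).
  { intros r hr hne.
    assert (k1 := hdiff r ta hr hne hta). assert (k2 := hdiff r tb hr hne htb).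
    rewrite hh', e1 in k1, k2 by trivial.
    destruct (affine_two_zeros (p r - p r1) (g0 * (q r - q r1) - (g r - g r1)) _ _ hab')
      as [l1 l2]; [lra|lra|].
    unfold be. lra. }
  apply (steady_height_riccati_sign a2 a1 b al be g0 r1); trivial.
  + intros r hr hne. unfold al. rewrite e1, Rmult_0_r, Rplus_0_r. now apply hrad.
  + intros r hr hne. rewrite <- (proj2 (hrad r hr hne)). unfold g, q. field. repeat apply conj; trivial; lra.
  + intros r hr. rewrite hflux, hl0 by trivial. ring.
- assert (hl : lambda = 2 * al) by (apply Rmult_integral in hlam1; destruct hlam1; [lra|tauto]).
  (* With this [E], eliminating [a1'] between the two coefficients of the momentum equation leaves
     [E a2 a2' = b + b^2 / r]. *)
  set (E := - g0 / g1).
  assert (hbe : be = al * E).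
  { unfold E. apply (Rmult_eq_reg_l (2 * g1)); [|lra].
    transitivity (- lambda * g0); [lra|]. rewrite hl. field. trivial. }
  assert (hal : al <> 0).
  { intros e. apply hua. rewrite hdu, hbe, e by trivial. ring. }
  assert (hE : E < 0).
  { apply (steady_momentum_coefficient_negative a2 b E r1); trivial.
    intros r hr.
    assert (ka := hmom r ta hr hta). assert (kb := hmom r tb hr htb).
    rewrite hdu, hh' in ka, kb by trivial.
    destruct (affine_two_zeros (- al * a2 r + a2 r * Derive a2 r + g1 * Derive a1 r)
      (be * a2 r + g0 * Derive a1 r - (b r + (b r)^2 / r)) _ _ hab') as [l1 l2]; [lra|lra|].
    transitivity (E * (- al * a2 r + a2 r * Derive a2 r + g1 * Derive a1 r)
      + be * a2 r + g0 * Derive a1 r); [|rewrite l1; lra].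
    rewrite hbe. unfold E. field. trivial. }
  rewrite hbe. replace (al * (al * E)) with (al^2 * E) by ring.
  assert (k := Rmult_lt_0_compat (al^2) (- E) (pow2_gt_0 al hal) ltac:(lra)). lra.
Qed.

Theorem theorem1p3 (T : Rbar) (h U V : R -> R -> R)
  (hT : Rbar_lt (Finite 0) T)
  (hsol : classical_solution T h U V)
  (hsep : separated T h U V) :
  (exists h' U' V' : R -> R -> R,
     continuation T h U V p_infty h' U' V' /\ time_periodic h' U' V')
  \/
  (exists (Tb : R) (h' U' V' : R -> R -> R),
     continuation T h U V (Finite Tb) h' U' V' /\ blows_up_at Tb h' U' V').
Proof.
change (periodic_or_blowup T h U V).
destruct hsep as [f1 [f2 [f3 [c1 [c2 [c3 hf]]]]]].
destruct (differentiable_factors T h f1 c1) as [hh [a1 [e1 [x1 [y1 z1]]]]].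
{ intros r t hd. now apply hsol. }
{ intros r t hd. now apply hf. }
destruct (differentiable_factors T U f2 c2) as [u [a2 [e2 [x2 [y2 z2]]]]].
{ intros r t hd. now apply hsol. }
{ intros r t hd. now apply hf. }
destruct (differentiable_factors T V f3 c3) as [v [a3 [e3 [x3 [y3 z3]]]]].
{ intros r t hd. now apply hsol. }
{ intros r t hd. now apply hf. }
assert (hrep : represents T h U V hh u v a1 a2 a3).
{ intros r t hd. auto. }
assert (hs : separated_system T hh u v a1 a2 a3).
{ apply (solution_separated_system T h U V); trivial; auto. }
assert (hs' := hs). destruct hs' as [hex [hexr heq]].
destruct z2 as [[r1 [t2 [hr1 [ht2 [hne1 hu2]]]]]|[hu ha2]].
- destruct (height_equation T hh u v a1 a2 a3 t2 hs ht2 hu2 z1) as [lambda [hl1 hl2]].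
  destruct (classic (exists t, time_dom T t /\ Derive v t <> 0)) as [[t3 [ht3 hdv]]|hno].
  + destruct z3 as [[r3 [t4 [hr3 [_ [hne3 _]]]]]|[hv1 _]].
    * now apply (unsteady_swirl_outcome T lambda h U V hh u v a1 a2 a3 r1 r3 t3).
    * exfalso. apply hdv. rewrite (Derive_ext v (fun _ => 1)) by trivial. apply Derive_const.
  + apply (steady_swirl_outcome T lambda h U V hh u v a1 a2 a3 r1 t2); trivial.
    intros t ht. apply NNPP. intros k. apply hno. now exists t.
- apply (steady_outcome T h U V hh u v a1 a2 a3); trivial.
  assert (hda2 : forall r, Derive a2 r = 0).
  { intros r. rewrite (Derive_ext a2 (fun _ => 0)) by trivial. apply Derive_const. }
  intros t ht. split; [|split].
  + destruct z1 as [[r [_ [hr [_ [hne _]]]]]|[h1 _]].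
    * destruct (heq r t hr ht) as [e _]. rewrite ha2, hda2 in e.
      assert (k : Derive hh t * a1 r = 0) by (rewrite <- e; unfold Rdiv; ring).
      apply Rmult_integral in k. tauto.
    * rewrite (Derive_ext hh (fun _ => 1)) by trivial. apply Derive_const.
  + rewrite (Derive_ext u (fun _ => 1)) by trivial. apply Derive_const.
  + destruct z3 as [[r [_ [hr [_ [hne _]]]]]|[h1 _]].
    * destruct (heq r t hr ht) as [_ [_ e]]. rewrite ha2 in e.
      assert (k : Derive v t * a3 r = 0) by (rewrite <- e; unfold Rdiv; ring).
      apply Rmult_integral in k. tauto.
    * rewrite (Derive_ext v (fun _ => 1)) by trivial. apply Derive_const.
Qed.
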